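(* Let $G_1, G_2\in\mathcal{G}$, where $G_i(a)=\frac12(\overline{\sigma}_{G_i}^2a^+-\underline{\sigma}_{G_i}^2a^-)$ with $0<\underline{\sigma}_{G_i}\le\overline{\sigma}_{G_i}<\infty$, and set $\beta_{G_i}:=\overline{\sigma}_{G_i}/\underline{\sigma}_{G_i}$ for $i=1,2$. Then $N_{G_1}*N_{G_2}=N_{G_2}*N_{G_1}$ (as functionals on $C_{b,Lip}(\mathbb{R})$) if and only if $\beta_{G_1}=\beta_{G_2}$.
   Context: $C_{b,Lip}(\mathbb{R})$ is the set of bounded Lipschitz functions $\varphi:\mathbb{R}\to\mathbb{R}$. For $a\in\mathbb{R}$ write $a^+=\max(a,0)$, $a^-=\max(-a,0)$. $\mathcal{G}^0$ is the collection of functions $G:\mathbb{R}\to\mathbb{R}$ of the form $G(a)=\frac12(\overline{\sigma}^2a^+-\underline{\sigma}^2a^-)$ with constants $0\le\underline{\sigma}\le\overline{\sigma}<\infty$. $\mathcal{G}\subset\mathcal{G}^0$ is the subset of those $G$ with $\underline{\sigma}>0$. For $G\in\mathcal{G}^0$ and $\varphi\in C_{b,Lip}(\mathbb{R})$, let $u^\varphi$ be the (unique bounded continuous) viscosity solution on $[0,\infty)\times\mathbb{R}$ of the $G$-heat equation $\partial_t u-G(\partial_x^2u)=0$ on $(0,\infty)\times\mathbb{R}$ with $u(0,x)=\varphi(x)$. The (one-dimensional) $G$-normal distribution $N_G$ is the functional on $C_{b,Lip}(\mathbb{R})$ defined by $N_G[\varphi]=u^\varphi(1,0)$. For $G_1,G_2\in\mathcal{G}^0$,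 the convolution $N_{G_1}*N_{G_2}$ is the functional on $C_{b,Lip}(\mathbb{R})$ defined by $N_{G_1}*N_{G_2}[\varphi]:=N_{G_1}[\phi]$, where $\phi(x):=N_{G_2}[\varphi(x+\cdot)]$. *)

(* Defs.v *)
From Stdlib Require Import Reals ClassicalEpsilon.
From Coquelicot Require Import Coquelicot.
Open Scope R_scope.

Definition pos_part (a : R) : R := Rmax a 0.
Definition neg_part (a : R) : R := Rmax (- a) 0.

(** [sl], [su] are the lower and upper volatilities. *)
Definition Gfun (sl su : R) (a : R) : R :=
  1 / 2 * (su ^ 2 * pos_part a - sl ^ 2 * neg_part a).

Definition CbLip (phi : R -> R) : Prop :=
  (exists M, forall x, Rabs (phi x) <= M) /\
  (exists L, forall x y, Rabs (phi x - phi y) <= L * Rabs (x - y)).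

(** Functions on space-time are curried, time first. *)
Definition Dt (psi : R -> R -> R) (t x : R) : R := Derive (fun s => psi s x) t.
Definition Dx (psi : R -> R -> R) (t x : R) : R := Derive (psi t) x.
Definition Dxx (psi : R -> R -> R) (t x : R) : R := Derive (Dx psi t) x.

(** Class C^{1,2} on the open half-plane (0,oo) x R.  The differentiability
    clauses are needed because [Derive] is total. *)
Definition C12 (psi : R -> R -> R) : Prop :=
  forall t x, 0 < t ->
    ex_derive (fun s => psi s x) t /\
    ex_derive (psi t) x /\
    ex_derive (Dx psi t) x /\
    continuity_2d_pt psi t x /\
    continuity_2d_pt (Dt psi) t x /\
    continuity_2d_pt (Dx psi) t x /\
    continuity_2d_pt (Dxx psi) t x.

Definition viscosity_subsolution (G : R -> R) (u : R -> R -> R) : Prop :=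
  forall (psi : R -> R -> R) (t x : R), 0 < t -> C12 psi ->
    locally_2d (fun s y => u s y - psi s y <= u t x - psi t x) t x ->
    Dt psi t x - G (Dxx psi t x) <= 0.

Definition viscosity_supersolution (G : R -> R) (u : R -> R -> R) : Prop :=
  forall (psi : R -> R -> R) (t x : R), 0 < t -> C12 psi ->
    locally_2d (fun s y => u s y - psi s y >= u t x - psi t x) t x ->
    Dt psi t x - G (Dxx psi t x) >= 0.

(** Relative continuity on the closed half-plane [0,oo) x R. *)
Definition continuous_closed_half_plane (u : R -> R -> R) : Prop :=
  forall t x, 0 <= t ->
    filterlim (fun p : R * R => u (fst p) (snd p))
      (within (fun p : R * R => 0 <= fst p) (locally (t, x)))
      (locally (u t x)).

Definition bounded_closed_half_plane (u : R -> R -> R) : Prop :=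
  exists M, forall t x, 0 <= t -> Rabs (u t x) <= M.

(** The values of [u] at negative times are irrelevant. *)
Definition G_heat_solution (G phi : R -> R) (u : R -> R -> R) : Prop :=
  bounded_closed_half_plane u /\
  continuous_closed_half_plane u /\
  viscosity_subsolution G u /\
  viscosity_supersolution G u /\
  (forall x, u 0 x = phi x).

(** For [phi] in [CbLip] the solution exists and is unique on [0,oo) x R, so
    the choice only affects negative times; without a solution, [epsilon]
    returns an unspecified function. *)
Definition G_heat (G phi : R -> R) : R -> R -> R :=
  epsilon (inhabits (fun _ _ : R => 0)) (G_heat_solution G phi).

Definition G_normal (G phi : R -> R) : R := G_heat G phi 1 0.

Definition convolution (N1 N2 : (R -> R) -> R) (phi : R -> R) : R :=
  N1 (fun x => N2 (fun y => phi (x + y))).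

Definition eq_on_CbLip (N1 N2 : (R -> R) -> R) : Prop :=
  forall phi, CbLip phi -> N1 phi = N2 phi.

(* Main.v *)
(** A discrete approximation carries the whole theory.  Let [step h f] be the
    larger of the two averages of [f] over [x - s sqrt h, x + s sqrt h] for
    [s = sl, su].  On a smooth [f] it equals [f + h G(f'') + O(h^(3/2))], and since
    [G] is convex, mollification [A] satisfies [step h (A f) <= A (step h f)];
    comparing mollified iterates therefore shows that the iterates converge to
    an operator [heat t].  Quartic polynomials are exact barriers for the
    equation, so a viscosity subsolution obeys the same one-step upper bound as
    the scheme and lies below [heat].  A supersolution solves each
    linear equation [u_t >= s^2/2 u_xx] and, linear averaging commuting
    with [A], lies above.  This gives existence, uniqueness and the semigroup law.

    If the ratios agree, the two semigroups are time changes of one another and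
    commute.  Otherwise let [b1 < b2] be the ratios and [phi_b] Song's periodic
    eigenfunction: the normalized [phi_b1] exceeds [phi_b2] by a positive
    constant [d].  The iterates of the first operator send [phi_b1] to [0],
    those of the second keep it above [d/2] eventually; commuting operators
    cannot do both. *)
Require Import Defs.
From Stdlib Require Import Reals Lra Lia Psatz FunctionalExtensionality Classical ClassicalEpsilon.
From Coquelicot Require Import Coquelicot.
Open Scope R_scope.

(** * The scheme *)

(** Comparison of viscosity solutions is usually proved by doubling the variables and passing
    through second-order jets. Here it is replaced by comparison with the scheme, and viscosity
    inequalities meet only explicit quartics. The price is a smooth intermediary: the iterates are
    merely [L]-Lipschitz, so a mollification of width [e] costs order [L * e] and leaves a cubic
    Taylor constant [L / e ^ 2]. Over a time [t] the Taylor errors add up to order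
    [t * L * sqrt h / e ^ 2]; hence [e] is fixed first and [h] tends to 0 afterwards. The two bounds
    are not symmetric because [step] and mollification commute only up to an inequality of one
    direction. For the other bound the candidate itself is mollified, and the sign of its curvature
    selects the volatility that realises [G]. The eigenfunctions are normalised by slope and not by
    height. Then the crest is [1 / k1 b], the trough is [- 1 / k2 b], and [1 / k1 b + 1 / k2 b = 2]
    for every ratio: raising the ratio lowers crest and trough by the same amount, which is the gap
    [d]. *)

Definition Lip (L : R) (f : R -> R) : Prop :=
  forall x y, Rabs (f x - f y) <= L * Rabs (x - y).

Definition walk (s : R) (f : R -> R) (x : R) : R := (f (x + s) + f (x - s)) / 2.

(** The two extreme volatilities suffice because [s ^ 2 / 2 * a] is linear in [s ^ 2], so its
    maximum over [[sl, su]] is reached at an end. *)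
Definition step (sl su h : R) (f : R -> R) (x : R) : R :=
  Rmax (walk (sl * sqrt h) f x) (walk (su * sqrt h) f x).

Definition scheme (sl su h : R) (n : nat) (f : R -> R) : R -> R :=
  Nat.iter n (step sl su h) f.

Lemma Gfun_ge sl su s b : 0 <= sl -> sl <= s -> s <= su -> s ^ 2 / 2 * b <= Gfun sl su b.
Proof.
  intros H0 H1 H2. unfold Gfun, pos_part, neg_part, Rmax.
  assert (sl ^ 2 <= s ^ 2) by nra. assert (s ^ 2 <= su ^ 2) by nra.
  destruct (Rle_dec b 0), (Rle_dec (- b) 0); nra.
Qed.

Lemma Gfun_pos sl su b : 0 <= b -> Gfun sl su b = su ^ 2 / 2 * b.
Proof.
  intros H. unfold Gfun, pos_part, neg_part.
  rewrite Rmax_left, Rmax_right by lra. lra.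
Qed.

Lemma Gfun_neg sl su b : b <= 0 -> Gfun sl su b = sl ^ 2 / 2 * b.
Proof.
  intros H. unfold Gfun, pos_part, neg_part.
  rewrite Rmax_right, Rmax_left by lra. lra.
Qed.

Lemma Gfun_diag s b : Gfun s s b = s ^ 2 / 2 * b.
Proof.
  destruct (Rle_dec 0 b).
  - now apply Gfun_pos.
  - apply Gfun_neg; lra.
Qed.

(** One-sided ellipticity: it prices an error in the second derivative, both in the Taylor estimates
    and for the barriers. *)
Lemma Gfun_add_le sl su a b : 0 <= sl -> sl <= su -> 0 <= b ->
  Gfun sl su (a + b) <= Gfun sl su a + su ^ 2 / 2 * b.
Proof.
  intros H0 H1 Hb. assert (sl ^ 2 <= su ^ 2) by nra.
  destruct (Rle_dec 0 a); [|destruct (Rle_dec 0 (a + b))].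
  - rewrite !Gfun_pos by lra. lra.
  - rewrite Gfun_pos, Gfun_neg by lra. nra.
  - rewrite !Gfun_neg by lra. nra.
Qed.

Section Scheme.
Variables (sl su h : R).

Lemma scheme_add n m f : scheme sl su h (n + m) f = scheme sl su h n (scheme sl su h m f).
Proof. unfold scheme. now rewrite Nat.iter_add. Qed.

Lemma step_le f g x : (forall y, f y <= g y) -> step sl su h f x <= step sl su h g x.
Proof.
  intros H. unfold step, walk.
  apply Rmax_lub; [eapply Rle_trans; [|apply Rmax_l] | eapply Rle_trans; [|apply Rmax_r]];
    apply Rmult_le_compat_r; try lra; apply Rplus_le_compat; apply H.
Qed.

Lemma scheme_le n f g : (forall y, f y <= g y) ->
  forall x, scheme sl su h n f x <= scheme sl su h n g x.
Proof.
  intros H. induction n as [|n IH]; simpl; auto.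
  intros x. now apply step_le.
Qed.

Lemma step_addc c f x : step sl su h (fun y => f y + c) x = step sl su h f x + c.
Proof.
  unfold step.
  replace (walk (sl * sqrt h) (fun y => f y + c) x) with (walk (sl * sqrt h) f x + c)
    by (unfold walk; lra).
  replace (walk (su * sqrt h) (fun y => f y + c) x) with (walk (su * sqrt h) f x + c)
    by (unfold walk; lra).
  symmetry; apply Rplus_max_distr_r.
Qed.

Lemma scheme_addc n c f x :
  scheme sl su h n (fun y => f y + c) x = scheme sl su h n f x + c.
Proof.
  revert x. induction n as [|n IH]; intros x; simpl; auto.
  now rewrite <- step_addc, (functional_extensionality _ _ IH).
Qed.

Lemma scheme_const n c x : scheme sl su h n (fun _ => c) x = c.
Proof.
  revert x. induction n as [|n IH]; intros x; simpl; auto.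
  unfold step, walk. rewrite !IH, Rmax_left by lra. lra.
Qed.

Lemma scheme_le_addc n c f g : (forall y, f y <= g y + c) ->
  forall x, scheme sl su h n f x <= scheme sl su h n g x + c.
Proof. intros H x. rewrite <- scheme_addc. now apply scheme_le. Qed.

Lemma scheme_scal n c f x : 0 <= c ->
  scheme sl su h n (fun y => c * f y) x = c * scheme sl su h n f x.
Proof.
  intros Hc. revert x. induction n as [|n IH]; intros x; simpl; auto.
  unfold step. rewrite <- RmaxRmult by lra. unfold walk. rewrite !IH. f_equal; lra.
Qed.

Lemma scheme_transl n c f x :
  scheme sl su h n (fun y => f (c + y)) x = scheme sl su h n f (c + x).
Proof.
  revert x. induction n as [|n IH]; intros x; simpl; auto.
  unfold step, walk, Rminus. now rewrite !IH, <- !Rplus_assoc.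
Qed.

(** Translation invariance, monotonicity and commutation with constants are enough: the translate of
    [f] by [a - b] lies below [f + L * Rabs (a - b)]. The same argument serves for [box] and
    [heat]. *)
Lemma Lip_scheme n L f : Lip L f -> Lip L (scheme sl su h n f).
Proof.
  intros H x y.
  assert (K : forall x y, scheme sl su h n f x <= scheme sl su h n f y + L * Rabs (x - y)).
  { intros a b. replace a with ((a - b) + b) at 1 by ring. rewrite <- scheme_transl.
    apply scheme_le_addc. intros z. specialize (H (a - b + z) z).
    replace (a - b + z - z) with (a - b) in H by ring.
    pose proof (Rle_abs (f (a - b + z) - f z)). lra. }
  pose proof (K x y). pose proof (K y x). rewrite (Rabs_minus_sym y x) in *.
  apply Rabs_le. lra.
Qed.

Lemma scheme_subadd n f g x :
  scheme sl su h n (fun y => f y + g y) x <= scheme sl su h n f x + scheme sl su h n g x.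
Proof.
  revert x. induction n as [|n IH]; intros x; simpl; try lra.
  eapply Rle_trans; [apply step_le, IH|].
  unfold step. set (F := scheme sl su h n f). set (K := scheme sl su h n g).
  fold (scheme sl su h n f) (scheme sl su h n g). fold F K.
  apply Rmax_lub.
  - pose proof (Rmax_l (walk (sl * sqrt h) F x) (walk (su * sqrt h) F x)).
    pose proof (Rmax_l (walk (sl * sqrt h) K x) (walk (su * sqrt h) K x)).
    unfold walk in *; lra.
  - pose proof (Rmax_r (walk (sl * sqrt h) F x) (walk (su * sqrt h) F x)).
    pose proof (Rmax_r (walk (sl * sqrt h) K x) (walk (su * sqrt h) K x)).
    unfold walk in *; lra.
Qed.

End Scheme.

(** With equal volatilities the two arguments of the maximum coincide, so [scheme s s] is the linear
    random walk of volatility [s]. *)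
Lemma scheme_diag_le sl su s h n f x : s = sl \/ s = su ->
  scheme s s h n f x <= scheme sl su h n f x.
Proof.
  intros Hs. revert x. induction n as [|n IH]; intros x; simpl; try lra.
  eapply Rle_trans; [apply step_le, IH|].
  unfold step at 1. rewrite Rmax_left by lra.
  destruct Hs as [-> | ->]; unfold step; [apply Rmax_l | apply Rmax_r].
Qed.

Lemma scheme_diag_opp s h n f x :
  scheme s s h n (fun y => - f y) x = - scheme s s h n f x.
Proof.
  revert x. induction n as [|n IH]; intros x; simpl; auto.
  unfold step. rewrite !Rmax_left by lra. unfold walk. rewrite !IH. lra.
Qed.

(** Diffusive scaling, used later to bring every nonnegative time to time 1. *)
Lemma scheme_rescale sl su r h n f x : 0 <= r -> 0 <= h ->
  scheme sl su (r ^ 2 * h) n f (r * x) = scheme sl su h n (fun y => f (r * y)) x.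
Proof.
  intros Hr Hh. revert x. induction n as [|n IH]; intros x; simpl; auto.
  unfold step, walk. rewrite <- !IH.
  assert (Hs : sqrt (r ^ 2 * h) = r * sqrt h).
  { rewrite sqrt_mult by nra. f_equal.
    replace (r ^ 2) with (r * r) by ring. now apply sqrt_square. }
  simpl in Hs. simpl. rewrite Hs.
  replace (r * x + sl * (r * sqrt h)) with (r * (x + sl * sqrt h)) by ring.
  replace (r * x - sl * (r * sqrt h)) with (r * (x - sl * sqrt h)) by ring.
  replace (r * x + su * (r * sqrt h)) with (r * (x + su * sqrt h)) by ring.
  replace (r * x - su * (r * sqrt h)) with (r * (x - su * sqrt h)) by ring.
  reflexivity.
Qed.

Lemma scheme_scale_vol sl su r h n f : 0 <= r -> 0 <= h ->
  scheme (r * sl) (r * su) h n f = scheme sl su (r ^ 2 * h) n f.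
Proof.
  intros Hr Hh. unfold scheme. f_equal.
  extensionality g. extensionality x. unfold step.
  assert (Hs : sqrt (r ^ 2 * h) = r * sqrt h).
  { rewrite sqrt_mult by nra. f_equal.
    replace (r ^ 2) with (r * r) by ring. now apply sqrt_square. }
  rewrite Hs. f_equal; f_equal; ring.
Qed.

(** [sqrt] vanishes on nonpositive numbers, so the walks do not move. This makes [heat] the identity
    at times [t <= 0]. *)
Lemma scheme_nonpos_time sl su h n f : h <= 0 -> scheme sl su h n f = f.
Proof.
  intros Hh. induction n as [|n IH]; simpl; auto.
  fold (scheme sl su h n f). rewrite IH. extensionality x.
  unfold step. rewrite sqrt_neg_0 by lra. rewrite !Rmult_0_r, Rmax_left by lra.
  unfold walk. rewrite Rplus_0_r, Rminus_0_r. lra.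
Qed.

(** The quartic is the Taylor model: it makes [PolyUp] usable with a test
    polynomial that dominates a bounded function globally. *)
Definition PolyUp (sl su h : R) (f u : R -> R) : Prop :=
  forall x c p b C, 0 <= C ->
    (forall y, f y <= c + p * (y - x) + b / 2 * (y - x) ^ 2 + C * (y - x) ^ 4) ->
    u x <= c + h * Gfun sl su b + 3 * C * su ^ 4 * h ^ 2.

Definition PolyLo (sl su h : R) (f u : R -> R) : Prop :=
  forall x c p b C, 0 <= C ->
    (forall y, c + p * (y - x) + b / 2 * (y - x) ^ 2 - C * (y - x) ^ 4 <= f y) ->
    c + h * Gfun sl su b - 3 * C * su ^ 4 * h ^ 2 <= u x.

(** * Polynomial bounds for the scheme *)

Section Moments.
Variables (sl su : R).
Hypotheses (Hsl : 0 <= sl) (Hsu : sl <= su).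

(** The quartic family is stable under averaging: a walk of step [q] turns [z ^ 4] into
    [z ^ 4 + 6 * z ^ 2 * q ^ 2 + q ^ 4]. The coefficients [6 * su ^ 2 * T] and [3 * su ^ 4 * T ^ 2]
    are those of the fourth moment of a Gaussian of variance [su ^ 2 * T]; the growth of the last
    one from [T] to [T + tau] absorbs [q ^ 4] and the cross term. The resulting bound sees only the
    total time. *)
Lemma PolyUp_scheme tau n f : 0 <= tau ->
  PolyUp sl su (INR n * tau) f (scheme sl su tau n f).
Proof.
  intros Ht x c p b C HC Hf.
  assert (K : forall y, scheme sl su tau n f y <=
    c + p * (y - x) + b / 2 * (y - x) ^ 2 + INR n * tau * Gfun sl su b
    + C * ((y - x) ^ 4 + 6 * su ^ 2 * (INR n * tau) * (y - x) ^ 2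
           + 3 * su ^ 4 * (INR n * tau) ^ 2)).
  { induction n as [|n IH].
    - intros y. simpl INR. simpl scheme. specialize (Hf y). lra.
    - intros y. rewrite S_INR.
      set (T := INR n * tau) in *. replace ((INR n + 1) * tau) with (T + tau) by (unfold T; ring).
      assert (HT : 0 <= T) by (apply Rmult_le_pos; auto; apply pos_INR).
      change (scheme sl su tau (S n) f y) with (step sl su tau (scheme sl su tau n f) y).
      eapply Rle_trans; [apply step_le, IH|]. clear IH Hf.
      assert (W : forall s, sl <= s <= su ->
        walk (s * sqrt tau) (fun y => c + p * (y - x) + b / 2 * (y - x) ^ 2 + T * Gfun sl su b
           + C * ((y - x) ^ 4 + 6 * su ^ 2 * T * (y - x) ^ 2 + 3 * su ^ 4 * T ^ 2)) y
        <= c + p * (y - x) + b / 2 * (y - x) ^ 2 + (T + tau) * Gfun sl su b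
           + C * ((y - x) ^ 4 + 6 * su ^ 2 * (T + tau) * (y - x) ^ 2 + 3 * su ^ 4 * (T + tau) ^ 2)).
      { intros s Hs. set (z := y - x). unfold walk.
        replace (y + s * sqrt tau - x) with (z + s * sqrt tau) by (unfold z; ring).
        replace (y - s * sqrt tau - x) with (z - s * sqrt tau) by (unfold z; ring).
        set (q := s * sqrt tau).
        assert (Hq : q ^ 2 = s ^ 2 * tau).
        { unfold q. rewrite Rpow_mult_distr. f_equal. now apply pow2_sqrt. }
        assert (HG : s ^ 2 / 2 * b <= Gfun sl su b) by (apply Gfun_ge; lra).
        assert (H1 : b / 2 * q ^ 2 <= tau * Gfun sl su b) by (rewrite Hq; nra).
        assert (Hss : s ^ 2 <= su ^ 2) by nra.
        assert (H2 : q ^ 2 <= su ^ 2 * tau) by (rewrite Hq; nra).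
        assert (H3 : 0 <= q ^ 2) by nra.
        assert (H4 : q ^ 4 <= su ^ 4 * tau ^ 2).
        { replace (q ^ 4) with (q ^ 2 * q ^ 2) by ring.
          replace (su ^ 4 * tau ^ 2) with ((su ^ 2 * tau) * (su ^ 2 * tau)) by ring.
          apply Rmult_le_compat; lra. }
        assert (H5 : z ^ 4 + 6 * z ^ 2 * q ^ 2 + q ^ 4 + 6 * su ^ 2 * T * (z ^ 2 + q ^ 2) + 3 * su ^ 4 * T ^ 2
          <= z ^ 4 + 6 * su ^ 2 * (T + tau) * z ^ 2 + 3 * su ^ 4 * (T + tau) ^ 2).
        { assert (z ^ 2 * q ^ 2 <= z ^ 2 * (su ^ 2 * tau)) by (apply Rmult_le_compat_l; nra).
          assert (su ^ 2 * T * q ^ 2 <= su ^ 2 * T * (su ^ 2 * tau))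
            by (apply Rmult_le_compat_l; [apply Rmult_le_pos; nra | lra]).
          assert (0 <= su ^ 4 * tau ^ 2) by (apply Rmult_le_pos; nra).
          nra. }
        apply (Rmult_le_compat_l C) in H5; [|lra].
        replace ((c + p * (z + q) + b / 2 * (z + q) ^ 2 + T * Gfun sl su b +
          C * ((z + q) ^ 4 + 6 * su ^ 2 * T * (z + q) ^ 2 + 3 * su ^ 4 * T ^ 2) +
          (c + p * (z - q) + b / 2 * (z - q) ^ 2 + T * Gfun sl su b +
          C * ((z - q) ^ 4 + 6 * su ^ 2 * T * (z - q) ^ 2 + 3 * su ^ 4 * T ^ 2))) / 2)
        with (c + p * z + b / 2 * z ^ 2 + b / 2 * q ^ 2 + T * Gfun sl su b +
          C * (z ^ 4 + 6 * z ^ 2 * q ^ 2 + q ^ 4 + 6 * su ^ 2 * T * (z ^ 2 + q ^ 2) + 3 * su ^ 4 * T ^ 2))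
        by field.
        lra. }
      unfold step. apply Rmax_lub; apply W; lra. }
  specialize (K x). rewrite Rminus_diag in K. simpl in K. simpl. nra.
Qed.

Lemma PolyLo_scheme tau n f : 0 <= tau ->
  PolyLo sl su (INR n * tau) f (scheme sl su tau n f).
Proof.
  intros Ht x c p b C HC Hf.
  assert (K : forall y,
    c + p * (y - x) + b / 2 * (y - x) ^ 2 + INR n * tau * Gfun sl su b
    - C * ((y - x) ^ 4 + 6 * su ^ 2 * (INR n * tau) * (y - x) ^ 2
           + 3 * su ^ 4 * (INR n * tau) ^ 2) <= scheme sl su tau n f y).
  { induction n as [|n IH].
    - intros y. simpl INR. simpl scheme. specialize (Hf y). lra.
    - intros y. rewrite S_INR.
      set (T := INR n * tau) in *. replace ((INR n + 1) * tau) with (T + tau) by (unfold T; ring).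
      assert (HT : 0 <= T) by (apply Rmult_le_pos; auto; apply pos_INR).
      change (scheme sl su tau (S n) f y) with (step sl su tau (scheme sl su tau n f) y).
      eapply Rle_trans; [|apply step_le, IH]. clear IH Hf.
      (* From below, only a volatility that realises [Gfun sl su b] is useful; the sign of [b] tells
         which argument of the maximum that is. *)
      assert (W : forall s, sl <= s <= su -> s ^ 2 / 2 * b = Gfun sl su b ->
        c + p * (y - x) + b / 2 * (y - x) ^ 2 + (T + tau) * Gfun sl su b
           - C * ((y - x) ^ 4 + 6 * su ^ 2 * (T + tau) * (y - x) ^ 2 + 3 * su ^ 4 * (T + tau) ^ 2)
        <= walk (s * sqrt tau) (fun y => c + p * (y - x) + b / 2 * (y - x) ^ 2 + T * Gfun sl su b
           - C * ((y - x) ^ 4 + 6 * su ^ 2 * T * (y - x) ^ 2 + 3 * su ^ 4 * T ^ 2)) y).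
      { intros s Hs HG. set (z := y - x). unfold walk.
        replace (y + s * sqrt tau - x) with (z + s * sqrt tau) by (unfold z; ring).
        replace (y - s * sqrt tau - x) with (z - s * sqrt tau) by (unfold z; ring).
        set (q := s * sqrt tau).
        assert (Hq : q ^ 2 = s ^ 2 * tau).
        { unfold q. rewrite Rpow_mult_distr. f_equal. now apply pow2_sqrt. }
        assert (H1 : b / 2 * q ^ 2 = tau * Gfun sl su b) by (rewrite Hq, <- HG; field).
        assert (Hss : s ^ 2 <= su ^ 2) by nra.
        assert (H2 : q ^ 2 <= su ^ 2 * tau) by (rewrite Hq; nra).
        assert (H3 : 0 <= q ^ 2) by nra.
        assert (H4 : q ^ 4 <= su ^ 4 * tau ^ 2).
        { replace (q ^ 4) with (q ^ 2 * q ^ 2) by ring.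
          replace (su ^ 4 * tau ^ 2) with ((su ^ 2 * tau) * (su ^ 2 * tau)) by ring.
          apply Rmult_le_compat; lra. }
        assert (H5 : z ^ 4 + 6 * z ^ 2 * q ^ 2 + q ^ 4 + 6 * su ^ 2 * T * (z ^ 2 + q ^ 2) + 3 * su ^ 4 * T ^ 2
          <= z ^ 4 + 6 * su ^ 2 * (T + tau) * z ^ 2 + 3 * su ^ 4 * (T + tau) ^ 2).
        { assert (z ^ 2 * q ^ 2 <= z ^ 2 * (su ^ 2 * tau)) by (apply Rmult_le_compat_l; nra).
          assert (su ^ 2 * T * q ^ 2 <= su ^ 2 * T * (su ^ 2 * tau))
            by (apply Rmult_le_compat_l; [apply Rmult_le_pos; nra | lra]).
          assert (0 <= su ^ 4 * tau ^ 2) by (apply Rmult_le_pos; nra).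
          nra. }
        apply (Rmult_le_compat_l C) in H5; [|lra].
        replace ((c + p * (z + q) + b / 2 * (z + q) ^ 2 + T * Gfun sl su b -
          C * ((z + q) ^ 4 + 6 * su ^ 2 * T * (z + q) ^ 2 + 3 * su ^ 4 * T ^ 2) +
          (c + p * (z - q) + b / 2 * (z - q) ^ 2 + T * Gfun sl su b -
          C * ((z - q) ^ 4 + 6 * su ^ 2 * T * (z - q) ^ 2 + 3 * su ^ 4 * T ^ 2))) / 2)
        with (c + p * z + b / 2 * z ^ 2 + b / 2 * q ^ 2 + T * Gfun sl su b -
          C * (z ^ 4 + 6 * z ^ 2 * q ^ 2 + q ^ 4 + 6 * su ^ 2 * T * (z ^ 2 + q ^ 2) + 3 * su ^ 4 * T ^ 2))
        by field.
        lra. }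
      unfold step. destruct (Rle_dec 0 b).
      + eapply Rle_trans; [|apply Rmax_r]. apply W; [lra | symmetry; now apply Gfun_pos].
      + eapply Rle_trans; [|apply Rmax_l]. apply W; [lra | symmetry; apply Gfun_neg; lra]. }
  specialize (K x). rewrite Rminus_diag in K. simpl in K. simpl. nra.
Qed.

(** The weight [sqrt h] balances the two terms: over a step of length [h] the quadratic one costs
    order [h * sqrt h] through [G], and the quartic one costs order [h ^ 2 / sqrt h], which is the
    same. The difference of the two sides is a multiple of a square. *)
Lemma cubic_young K d h : 0 <= K -> 0 < h ->
  K * Rabs d ^ 3 <= (K * sqrt h) / 2 * d ^ 2 + K / (2 * sqrt h) * d ^ 4.
Proof.
  intros HK Hh. assert (Hs : 0 < sqrt h) by now apply sqrt_lt_R0.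
  assert (E : d ^ 2 = Rabs d ^ 2) by (rewrite RPow_abs; symmetry; apply Rabs_pos_eq; nra).
  replace (d ^ 4) with (Rabs d ^ 2 * Rabs d ^ 2) by (rewrite <- E; ring). rewrite E.
  set (a := Rabs d). set (r := sqrt h) in *.
  replace (K * r / 2 * a ^ 2 + K / (2 * r) * (a ^ 2 * a ^ 2))
    with (K * a ^ 3 + K / (2 * r) * (a * (r - a)) ^ 2) by (field; lra).
  assert (0 <= K / (2 * r)) by (apply Rmult_le_pos; auto; left; apply Rinv_0_lt_compat; lra).
  pose proof (pow2_ge_0 (a * (r - a))). nra.
Qed.

(** The two summands are the costs of the quadratic and of the quartic term of [cubic_young]. *)
Definition kappa : R := (su ^ 2 + 3 * su ^ 4) / 2.

Lemma PolyUp_cubic h f u x c p b K : PolyUp sl su h f u -> 0 < h -> 0 <= K ->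
  (forall y, f y <= c + p * (y - x) + b / 2 * (y - x) ^ 2 + K * Rabs (y - x) ^ 3) ->
  u x <= c + h * Gfun sl su b + kappa * K * (h * sqrt h).
Proof.
  intros HP Hh HK Hf. assert (Hs : 0 < sqrt h) by now apply sqrt_lt_R0.
  assert (H0 : 0 <= K / (2 * sqrt h))
    by (apply Rmult_le_pos; auto; left; apply Rinv_0_lt_compat; lra).
  assert (H := HP x c p (b + K * sqrt h) (K / (2 * sqrt h)) H0).
  assert (Hy : forall y, f y <= c + p * (y - x) + (b + K * sqrt h) / 2 * (y - x) ^ 2 +
       K / (2 * sqrt h) * (y - x) ^ 4).
  { intros y. specialize (Hf y). pose proof (cubic_young K (y - x) h HK Hh). lra. }
  specialize (H Hy).
  pose proof (Gfun_add_le sl su b (K * sqrt h) Hsl Hsu ltac:(nra)) as HG.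
  apply (Rmult_le_compat_l h) in HG; [|lra].
  assert (E : 3 * (K / (2 * sqrt h)) * su ^ 4 * h ^ 2 = 3 * su ^ 4 / 2 * K * (h * sqrt h)).
  { replace (h ^ 2) with (h * (sqrt h * sqrt h)) by (rewrite sqrt_sqrt by lra; ring).
    field; lra. }
  unfold kappa. lra.
Qed.

Lemma PolyLo_cubic h f u x c p b K : PolyLo sl su h f u -> 0 < h -> 0 <= K ->
  (forall y, c + p * (y - x) + b / 2 * (y - x) ^ 2 - K * Rabs (y - x) ^ 3 <= f y) ->
  c + h * Gfun sl su b - kappa * K * (h * sqrt h) <= u x.
Proof.
  intros HP Hh HK Hf. assert (Hs : 0 < sqrt h) by now apply sqrt_lt_R0.
  assert (H0 : 0 <= K / (2 * sqrt h))
    by (apply Rmult_le_pos; auto; left; apply Rinv_0_lt_compat; lra).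
  assert (H := HP x c p (b - K * sqrt h) (K / (2 * sqrt h)) H0).
  assert (Hy : forall y, c + p * (y - x) + (b - K * sqrt h) / 2 * (y - x) ^ 2 -
       K / (2 * sqrt h) * (y - x) ^ 4 <= f y).
  { intros y. specialize (Hf y). pose proof (cubic_young K (y - x) h HK Hh). lra. }
  specialize (H Hy).
  (* Applied at the lowered curvature, so that adding [K * sqrt h] leads back to [b]. *)
  pose proof (Gfun_add_le sl su (b - K * sqrt h) (K * sqrt h) Hsl Hsu ltac:(nra)) as HG.
  replace (b - K * sqrt h + K * sqrt h) with b in HG by ring.
  apply (Rmult_le_compat_l h) in HG; [|lra].
  assert (E : 3 * (K / (2 * sqrt h)) * su ^ 4 * h ^ 2 = 3 * su ^ 4 / 2 * K * (h * sqrt h)).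
  { replace (h ^ 2) with (h * (sqrt h * sqrt h)) by (rewrite sqrt_sqrt by lra; ring).
    field; lra. }
  unfold kappa. lra.
Qed.

End Moments.

(** * Mollification *)

Lemma Lip_nonneg L f : Lip L f -> 0 <= L.
Proof.
  intros H. specialize (H 1 0). rewrite Rminus_0_r, Rabs_R1 in H.
  pose proof (Rabs_pos (f 1 - f 0)). lra.
Qed.

Lemma Lip_continuous L f : Lip L f -> forall x, continuous f x.
Proof.
  intros H x. apply continuity_pt_filterlim. intros eps Heps.
  pose proof (Lip_nonneg L f H).
  exists (eps / (L + 1)). split; [apply Rdiv_lt_0_compat; lra|].
  intros y [_ Hy]. simpl in *. unfold Rdist in *.
  apply Rle_lt_trans with (L * Rabs (y - x)); [apply H|].
  apply Rle_lt_trans with ((L + 1) * Rabs (y - x)).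
  - pose proof (Rabs_pos (y - x)). nra.
  - apply Rlt_le_trans with ((L + 1) * (eps / (L + 1))).
    + apply Rmult_lt_compat_l; lra.
    + right. field. lra.
Qed.

Lemma ex_RInt_cont (f : R -> R) a b : (forall x, continuous f x) -> ex_RInt f a b.
Proof. intros H. apply (@ex_RInt_continuous R_CompleteNormedModule). intros z _. apply H. Qed.

Lemma continuous_shift (f : R -> R) c :
  (forall x, continuous f x) -> forall x, continuous (fun y => f (c + y)) x.
Proof.
  intros H x. apply (continuous_comp (fun y => c + y) f); [|apply H].
  apply (continuous_plus (fun _ => c) (fun y : R => y)); [apply continuous_const | apply continuous_id].
Qed.

Definition box (e : R) (f : R -> R) (x : R) : R :=
  RInt (fun y => f (x + y)) (- e) e / (2 * e).

Lemma is_derive_sub_comp (F f : R -> R) a x : (forall z, is_derive F z (f z)) ->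
  is_derive (fun y => F (y + a)) x (f (x + a)).
Proof.
  intros H. evar_last.
  - apply (is_derive_comp F (fun y => y + a)); [apply H|].
    apply (is_derive_plus (fun y : R => y) (fun _ => a)); [apply is_derive_id | apply is_derive_const].
  - unfold scal, plus, one, zero; simpl. unfold mult; simpl. ring.
Qed.

Section Box.
Variable e : R.
Hypothesis He : 0 < e.

Lemma box_le f g x : (forall y, continuous f y) -> (forall y, continuous g y) ->
  (forall y, f y <= g y) -> box e f x <= box e g x.
Proof.
  intros Hf Hg H. unfold box. apply Rmult_le_compat_r.
  - left. apply Rinv_0_lt_compat. lra.
  - apply RInt_le; try lra; try (apply ex_RInt_cont, continuous_shift; assumption).
    intros y _. apply H.
Qed.

Lemma box_addc f c x : (forall y, continuous f y) ->
  box e (fun y => f y + c) x = box e f x + c.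
Proof.
  intros Hf. unfold box.
  rewrite (RInt_plus (fun y => f (x + y)) (fun _ => c));
    [|now apply ex_RInt_cont, continuous_shift | apply ex_RInt_const].
  rewrite RInt_const. unfold plus, scal; simpl; unfold mult; simpl. field. lra.
Qed.

Lemma box_const c x : box e (fun _ => c) x = c.
Proof.
  unfold box. rewrite RInt_const. unfold scal; simpl; unfold mult; simpl. field. lra.
Qed.

Lemma box_transl f c x : box e (fun y => f (c + y)) x = box e f (c + x).
Proof.
  unfold box. f_equal. apply RInt_ext. intros y _. f_equal. ring.
Qed.

Lemma box_walk f s x : (forall y, continuous f y) ->
  box e (walk s f) x = walk s (box e f) x.
Proof.
  intros Hf.
  assert (H1 : forall c, ex_RInt (fun y => f (c + y)) (- e) e)
    by (intros c; now apply ex_RInt_cont, continuous_shift).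
  assert (E : RInt (fun y => (f (x + y + s) + f (x + y - s)) / 2) (- e) e
    = / 2 * (RInt (fun y => f (x + s + y)) (- e) e + RInt (fun y => f (x - s + y)) (- e) e)).
  { apply (@is_RInt_unique R_CompleteNormedModule).
    apply (is_RInt_ext (fun y => scal (/ 2) (plus (f (x + s + y)) (f (x - s + y))))).
    - intros y _. unfold plus, scal; simpl; unfold mult; simpl.
      replace (x + y + s) with (x + s + y) by ring.
      replace (x + y - s) with (x - s + y) by ring. field.
    - apply (is_RInt_scal (fun y => plus (f (x + s + y)) (f (x - s + y)))),
        (is_RInt_plus (fun y => f (x + s + y)));
        apply (@RInt_correct R_CompleteNormedModule), H1. }
  unfold walk, box. rewrite E. field. lra.
Qed.

Lemma Lip_box L f : Lip L f -> Lip L (box e f).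
Proof.
  intros H. pose proof (Lip_continuous L f H) as Hc.
  assert (K : forall x y, box e f x <= box e f y + L * Rabs (x - y)).
  { intros a b. replace a with ((a - b) + b) at 1 by ring. rewrite <- box_transl.
    rewrite <- box_addc by assumption. apply box_le.
    - now apply continuous_shift.
    - intros y. apply (continuous_plus f (fun _ => L * Rabs (a - b))); [apply Hc | apply continuous_const].
    - intros z. specialize (H (a - b + z) z).
      replace (a - b + z - z) with (a - b) in H by ring.
      pose proof (Rle_abs (f (a - b + z) - f z)). lra. }
  intros x y. pose proof (K x y). pose proof (K y x). rewrite (Rabs_minus_sym y x) in *.
  apply Rabs_le. lra.
Qed.

Lemma box_near L f x : Lip L f -> Rabs (box e f x - f x) <= L * e.
Proof.
  intros H. pose proof (Lip_continuous L f H) as Hc. pose proof (Lip_nonneg L f H).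
  assert (E : forall c, f x + c = RInt (fun _ : R => f x + c) (- e) e / (2 * e)).
  { intros c. symmetry. apply (box_const (f x + c) 0). }
  assert (K : forall y, - e < y < e -> Rabs (f (x + y) - f x) <= L * e).
  { intros y Hy. eapply Rle_trans; [apply H|]. replace (x + y - x) with y by ring.
    apply Rmult_le_compat_l; auto. apply Rabs_le. lra. }
  assert (H2 : 0 <= / (2 * e)) by (left; apply Rinv_0_lt_compat; lra).
  assert (box e f x <= f x + L * e).
  { rewrite E. apply Rmult_le_compat_r; auto.
    apply RInt_le; [lra | now apply ex_RInt_cont, continuous_shift | apply ex_RInt_const |].
    intros y Hy. specialize (K y Hy). apply Rabs_le_between in K. lra. }
  assert (f x + - (L * e) <= box e f x).
  { rewrite E. apply Rmult_le_compat_r; auto.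
    apply RInt_le; [lra | apply ex_RInt_const | now apply ex_RInt_cont, continuous_shift |].
    intros y Hy. specialize (K y Hy). apply Rabs_le_between in K. lra. }
  apply Rabs_le. lra.
Qed.

Lemma is_derive_box f x : (forall y, continuous f y) ->
  is_derive (box e f) x ((f (x + e) - f (x - e)) / (2 * e)).
Proof.
  intros Hf. set (F := fun z => RInt f 0 z).
  assert (HF : forall z, is_derive F z (f z)).
  { intros z. apply (is_derive_RInt f F 0 z); [|apply Hf].
    apply filter_forall. intros y. apply (@RInt_correct R_CompleteNormedModule), ex_RInt_cont, Hf. }
  apply (is_derive_ext (fun z => scal (/ (2 * e)) (minus (F (z + e)) (F (z + - e))))).
  - intros z. unfold box.
    assert (E : RInt (fun y => f (z + y)) (- e) e = minus (F (z + e)) (F (z + - e))).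
    { apply (@is_RInt_unique R_CompleteNormedModule).
      apply (is_RInt_derive (fun y => F (z + y)) (fun y => f (z + y))).
      - intros y _. apply (is_derive_ext (fun y => F (y + z)));
          [intros t; now rewrite Rplus_comm|].
        rewrite Rplus_comm. now apply is_derive_sub_comp.
      - intros y _. now apply continuous_shift. }
    rewrite E. unfold minus, plus, opp, scal; simpl; unfold mult; simpl. field. lra.
  - evar_last.
    + apply (is_derive_scal (fun z => minus (F (z + e)) (F (z + - e))) x (/ (2 * e))).
      apply (is_derive_minus (fun z => F (z + e)) (fun z => F (z + - e)));
        apply is_derive_sub_comp; exact HF.
    + unfold minus, plus, opp, scal; simpl; unfold mult; simpl. unfold Rminus. field. lra.
Qed.

End Box.

(** One average of a Lipschitz function has a Lipschitz derivative; a second average gives a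
    Lipschitz second derivative, as a cubic Taylor remainder requires. *)
Definition mollify (e : R) (f : R -> R) : R -> R := box e (box e f).

(** The second derivative of [mollify e f]: differentiating an average yields a difference quotient,
    and doing so twice leaves no integral. *)
Definition mollify2 (e : R) (f : R -> R) (x : R) : R :=
  (f (x + 2 * e) - 2 * f x + f (x - 2 * e)) / (4 * e ^ 2).

Section Mollify.
Variables (e L : R) (f : R -> R).
Hypotheses (He : 0 < e) (Hf : Lip L f).

Lemma mollify_near x : Rabs (mollify e f x - f x) <= 2 * L * e.
Proof.
  pose proof (box_near e He L f x Hf).
  pose proof (box_near e He L (box e f) x (Lip_box e He L f Hf)).
  unfold mollify. replace (box e (box e f) x - f x)
    with ((box e (box e f) x - box e f x) + (box e f x - f x)) by ring.
  eapply Rle_trans; [apply Rabs_triang|]. lra.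
Qed.

Lemma mollify_le g M x : Lip M g -> (forall y, f y <= g y) -> mollify e f x <= mollify e g x.
Proof.
  intros Hg H. apply box_le; try assumption.
  - apply (Lip_continuous L), Lip_box; assumption.
  - apply (Lip_continuous M), Lip_box; assumption.
  - intros y. apply box_le; try assumption;
      [apply (Lip_continuous L) | apply (Lip_continuous M)]; assumption.
Qed.

Lemma mollify_addc c x : mollify e (fun y => f y + c) x = mollify e f x + c.
Proof.
  unfold mollify. rewrite <- box_addc.
  - f_equal. extensionality y. apply box_addc; [assumption | apply (Lip_continuous L), Hf].
  - assumption.
  - apply (Lip_continuous L), Lip_box; assumption.
Qed.

Lemma mollify_walk s x : mollify e (walk s f) x = walk s (mollify e f) x.
Proof.
  unfold mollify. rewrite <- box_walk.
  - f_equal. extensionality y. apply box_walk; [assumption | apply (Lip_continuous L), Hf].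
  - assumption.
  - apply (Lip_continuous L), Lip_box; assumption.
Qed.

Lemma mollify2_Lip : Lip (L / e ^ 2) (mollify2 e f).
Proof.
  intros x y. unfold mollify2.
  pose proof (Hf (x + 2 * e) (y + 2 * e)) as H1. pose proof (Hf x y) as H2.
  pose proof (Hf (x - 2 * e) (y - 2 * e)) as H3.
  replace (x + 2 * e - (y + 2 * e)) with (x - y) in H1 by ring.
  replace (x - 2 * e - (y - 2 * e)) with (x - y) in H3 by ring.
  apply Rabs_le_between in H1. apply Rabs_le_between in H2. apply Rabs_le_between in H3.
  set (D := Rabs (x - y)) in *.
  assert (E : L / e ^ 2 * D = 4 * (L * D) / (4 * e ^ 2)) by (field; lra).
  rewrite E. unfold Rdiv. rewrite <- Rmult_minus_distr_r.
  rewrite Rabs_mult, (Rabs_pos_eq (/ (4 * e ^ 2))) by (left; apply Rinv_0_lt_compat; nra).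
  apply Rmult_le_compat_r; [left; apply Rinv_0_lt_compat; nra|].
  apply Rabs_le. lra.
Qed.

Lemma mollify_derive (x : R) : is_derive (mollify e f) x ((box e f (x + e) - box e f (x - e)) / (2 * e)).
Proof. apply is_derive_box; [assumption|]. apply (Lip_continuous L), Lip_box; assumption. Qed.

Lemma mollify_derive2 (x : R) :
  is_derive (fun z => (box e f (z + e) - box e f (z - e)) / (2 * e)) x (mollify2 e f x).
Proof.
  assert (HB : forall z, is_derive (box e f) z ((f (z + e) - f (z - e)) / (2 * e))).
  { intros z. apply is_derive_box; [assumption | apply (Lip_continuous L), Hf]. }
  apply (is_derive_ext (fun z => scal (/ (2 * e)) (minus (box e f (z + e)) (box e f (z + - e))))).
  - intros z. unfold minus, plus, opp, scal; simpl; unfold mult; simpl. unfold Rminus. field. lra.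
  - evar_last.
    + apply (is_derive_scal (fun z => minus (box e f (z + e)) (box e f (z + - e))) x (/ (2 * e))).
      apply (is_derive_minus (fun z => box e f (z + e)) (fun z => box e f (z + - e)));
        apply (is_derive_sub_comp (box e f) (fun z => (f (z + e) - f (z - e)) / (2 * e))); exact HB.
    + change (/ (2 * e) * ((f (x + e + e) - f (x + e - e)) / (2 * e)
        - (f (x + - e + e) - f (x + - e - e)) / (2 * e)) = mollify2 e f x).
      unfold mollify2.
      replace (x + 2 * e) with (x + e + e) by ring.
      replace (x - 2 * e) with (x + - e - e) by ring.
      replace (x + - e + e) with x by ring. replace (x + e - e) with x by ring.
      field. lra.
Qed.

End Mollify.

(** The mean value theorem, used twice. Only a Lipschitz bound on [g2] at [x] is assumed, so the
    estimate also covers the glued eigenfunction, whose third derivative jumps when the ratio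
    exceeds 1. *)
Lemma taylor_cubic (g g1 g2 : R -> R) K x y :
  (forall z, is_derive g z (g1 z)) -> (forall z, is_derive g1 z (g2 z)) ->
  (forall z, Rabs (g2 z - g2 x) <= K * Rabs (z - x)) ->
  Rabs (g y - (g x + g1 x * (y - x) + g2 x / 2 * (y - x) ^ 2)) <= K * Rabs (y - x) ^ 3.
Proof.
  intros H1 H2 HK.
  assert (Hle : forall a b c, Rmin a b <= c <= Rmax a b -> Rabs (c - a) <= Rabs (b - a)).
  { intros a b c. unfold Rmin, Rmax, Rabs.
    destruct (Rle_dec a b), (Rcase_abs (c - a)), (Rcase_abs (b - a)); lra. }
  assert (K0 : 0 <= K).
  { specialize (HK (x + 1)). replace (x + 1 - x) with 1 in HK by ring.
    rewrite Rabs_R1 in HK. pose proof (Rabs_pos (g2 (x + 1) - g2 x)). lra. }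
  assert (C1 : forall z, Rabs (g1 z - g1 x - g2 x * (z - x)) <= K * Rabs (z - x) ^ 2).
  { intros z. destruct (MVT_gen g1 x z g2) as [c [Hc E]].
    - intros; apply H2.
    - intros t _. apply derivable_continuous_pt. exists (g2 t). apply is_derive_Reals, H2.
    - replace (g1 z - g1 x - g2 x * (z - x)) with ((g2 c - g2 x) * (z - x)) by lra.
      rewrite Rabs_mult. replace (K * Rabs (z - x) ^ 2) with (K * Rabs (z - x) * Rabs (z - x)) by ring.
      apply Rmult_le_compat_r; [apply Rabs_pos|].
      eapply Rle_trans; [apply HK|]. apply Rmult_le_compat_l; auto. }
  set (r := fun z => g z - (g x + g1 x * (z - x) + g2 x / 2 * (z - x) ^ 2)).
  assert (Hr : forall z, is_derive r z (g1 z - g1 x - g2 x * (z - x))).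
  { intros z. unfold r. evar_last.
    - apply (is_derive_minus g); [apply H1|].
      auto_derive; [trivial | reflexivity].
    - unfold minus, plus, opp; simpl. field. }
  destruct (MVT_gen r x y (fun z => g1 z - g1 x - g2 x * (z - x))) as [c [Hc E]].
  - intros; apply Hr.
  - intros t _. apply derivable_continuous_pt. eexists. apply is_derive_Reals, Hr.
  - assert (E0 : r x = 0) by (unfold r; ring).
    change (Rabs (r y) <= K * Rabs (y - x) ^ 3).
    replace (r y) with ((g1 c - g1 x - g2 x * (c - x)) * (y - x)) by lra.
    rewrite Rabs_mult.
    replace (K * Rabs (y - x) ^ 3) with (K * Rabs (y - x) ^ 2 * Rabs (y - x)) by ring.
    apply Rmult_le_compat_r; [apply Rabs_pos|].
    eapply Rle_trans; [apply C1|]. apply Rmult_le_compat_l; auto.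
    apply pow_incr. split; [apply Rabs_pos | auto].
Qed.

Lemma mollify_cubic e L f x : 0 < e -> Lip L f ->
  exists p, forall y, Rabs (mollify e f y
    - (mollify e f x + p * (y - x) + mollify2 e f x / 2 * (y - x) ^ 2))
    <= L / e ^ 2 * Rabs (y - x) ^ 3.
Proof.
  intros He Hf. eexists. intros y. eapply taylor_cubic.
  - intros z. now apply (mollify_derive e L).
  - intros z. now apply (mollify_derive2 e L).
  - intros z. now apply mollify2_Lip.
Qed.

(** This is where the convexity of [G] enters. *)
Lemma step_mollify_le sl su h e L f x : 0 < e -> Lip L f ->
  step sl su h (mollify e f) x <= mollify e (step sl su h f) x.
Proof.
  intros He Hf.
  assert (HS : Lip L (step sl su h f)) by exact (Lip_scheme sl su h 1 L f Hf).
  assert (HW : forall s, Lip L (walk s f)).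
  { intros s. assert (H := Lip_scheme s s 1 1 L f Hf).
    intros a b. specialize (H a b). simpl in H. unfold step in H.
    rewrite sqrt_1, !Rmax_left, Rmult_1_r in H by lra. exact H. }
  unfold step at 1. rewrite <- !(mollify_walk e L) by assumption.
  apply Rmax_lub; apply (mollify_le e L) with (M := L); auto; intros y; unfold step;
    [apply Rmax_l | apply Rmax_r].
Qed.

Lemma scheme_diag_mollify s h n e L f x : 0 < e -> Lip L f ->
  scheme s s h n (mollify e f) x = mollify e (scheme s s h n f) x.
Proof.
  intros He Hf. revert x. induction n as [|n IH]; intros x; simpl; auto.
  unfold step at 1. rewrite Rmax_left by lra.
  replace (step s s h (scheme s s h n f)) with (walk (s * sqrt h) (scheme s s h n f))
    by (extensionality y; unfold step; rewrite Rmax_left; lra).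
  rewrite (mollify_walk e L); [|assumption | now apply Lip_scheme].
  unfold walk. now rewrite !IH.
Qed.

(** * Convergence of the scheme *)

Lemma kappa_le s su : 0 <= s -> s <= su -> kappa s <= kappa su.
Proof.
  intros H0 H1. unfold kappa. assert (s ^ 2 <= su ^ 2) by nra.
  assert (s ^ 4 <= su ^ 4) by (apply pow_incr; lra). lra.
Qed.

Lemma kappa_nonneg su : 0 <= kappa su.
Proof.
  unfold kappa. pose proof (pow2_ge_0 su). pose proof (pow2_ge_0 (su ^ 2)).
  replace (su ^ 4) with ((su ^ 2) ^ 2) by ring. lra.
Qed.

(** Mollification is paid for at the start and at the end, [2 * L * e] each; every step pays two
    Taylor remainders with constant [L / e ^ 2]. *)
Definition scheme_err (su L e h : R) (n : nat) : R :=
  4 * L * e + INR n * (2 * kappa su * (L / e ^ 2) * (h * sqrt h)).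

Lemma scheme_err_small su L t eta : 0 <= L -> 0 < t -> 0 < eta ->
  exists N, forall n, (N <= n)%nat -> (1 <= n)%nat ->
    exists e, 0 < e /\ scheme_err su L e (t / INR n) n <= eta.
Proof.
  (* [e] depends on [eta] and [L] alone. With [h = t / INR n] the remaining error is [W * sqrt h],
     which a large [n] makes small. *)
  intros HL Ht Heta. set (e := eta / (8 * (L + 1))).
  assert (He : 0 < e) by (apply Rdiv_lt_0_compat; lra).
  set (W := t * (2 * kappa su * (L / e ^ 2))).
  assert (HW : 0 <= W).
  { apply Rmult_le_pos; [lra|]. apply Rmult_le_pos; [pose proof (kappa_nonneg su); lra|].
    apply Rdiv_le_0_compat; nra. }
  set (d := eta / (2 * (W + 1))).
  assert (Hd : 0 < d) by (apply Rdiv_lt_0_compat; lra).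
  destruct (nfloor_ex (t / d ^ 2)) as [N HN].
  { apply Rdiv_le_0_compat; nra. }
  exists (S N). intros n Hn Hn1. exists e. split; auto.
  assert (Hn0 : 0 < INR n) by (apply lt_0_INR; lia).
  assert (HNn : INR N + 1 <= INR n) by (rewrite <- S_INR; apply le_INR; lia).
  assert (Hs : sqrt (t / INR n) <= d).
  { rewrite <- (sqrt_square d) by lra. apply sqrt_le_1_alt.
    apply Rmult_le_reg_r with (INR n); auto.
    replace (t / INR n * INR n) with t by (field; lra).
    destruct HN as [_ HN]. apply (Rmult_lt_compat_r (d ^ 2)) in HN; [|nra].
    replace (t / d ^ 2 * d ^ 2) with t in HN by (field; nra). nra. }
  unfold scheme_err.
  replace (INR n * (2 * kappa su * (L / e ^ 2) * (t / INR n * sqrt (t / INR n))))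
    with (W * sqrt (t / INR n)) by (unfold W; field; split; lra).
  assert (H1 : 4 * L * e <= eta / 2).
  { unfold e. replace (eta / 2) with (4 * (L + 1) * (eta / (8 * (L + 1)))) by (field; lra).
    apply Rmult_le_compat_r; [fold e; lra | lra]. }
  assert (H2 : W * sqrt (t / INR n) <= eta / 2).
  { apply Rle_trans with ((W + 1) * d).
    - apply Rmult_le_compat; try lra. apply sqrt_pos.
    - right. unfold d. field. lra. }
  lra.
Qed.

Section Stability.
Variables (sl su h L e : R).
Hypotheses (Hsl : 0 <= sl) (Hsu : sl <= su) (Hh : 0 < h) (He : 0 < e).

Lemma smooth_step_lo f x : Lip L f ->
  mollify e f x + h * Gfun sl su (mollify2 e f x) - kappa su * (L / e ^ 2) * (h * sqrt h)
  <= step sl su h (mollify e f) x.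
Proof.
  intros Hf. destruct (mollify_cubic e L f x He Hf) as [p Hp].
  apply (PolyLo_cubic sl su Hsl Hsu h (mollify e f) _ x _ p).
  - assert (H := PolyLo_scheme sl su Hsl Hsu h 1 (mollify e f) ltac:(lra)).
    simpl INR in H. rewrite Rmult_1_l in H. exact H.
  - assumption.
  - apply Rdiv_le_0_compat; [now apply (Lip_nonneg L f) | nra].
  - intros y. specialize (Hp y). apply Rabs_le_between in Hp. lra.
Qed.

Lemma smooth_step_up f x : Lip L f ->
  step sl su h (mollify e f) x <=
  mollify e f x + h * Gfun sl su (mollify2 e f x) + kappa su * (L / e ^ 2) * (h * sqrt h).
Proof.
  intros Hf. destruct (mollify_cubic e L f x He Hf) as [p Hp].
  apply (PolyUp_cubic sl su Hsl Hsu h (mollify e f) _ x _ p).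
  - assert (H := PolyUp_scheme sl su Hsl Hsu h 1 (mollify e f) ltac:(lra)).
    simpl INR in H. rewrite Rmult_1_l in H. exact H.
  - assumption.
  - apply Rdiv_le_0_compat; [now apply (Lip_nonneg L f) | nra].
  - intros y. specialize (Hp y). apply Rabs_le_between in Hp. lra.
Qed.

(** No regularity of [u] is assumed, so slices of a viscosity subsolution qualify. The induction
    bounds [u n] by a mollified iterate, because that one has the Taylor polynomial that [PolyUp]
    takes; [smooth_step_lo] and [step_mollify_le] close the step. *)
Lemma scheme_upper f (u : nat -> R -> R) n x : Lip L f ->
  (forall k, PolyUp sl su h (u k) (u (S k))) -> (forall y, u 0%nat y <= f y) ->
  u n x <= scheme sl su h n f x + scheme_err su L e h n.
Proof.
  intros Hf HP H0. set (q := 2 * kappa su * (L / e ^ 2) * (h * sqrt h)).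
  assert (HL : 0 <= L) by now apply (Lip_nonneg L f).
  assert (K : forall y, u n y <= mollify e (scheme sl su h n f) y + (2 * L * e + INR n * q)).
  { induction n as [|n IH]; intros y.
    - simpl. pose proof (mollify_near e L f He Hf y) as M. apply Rabs_le_between in M.
      specialize (H0 y). lra.
    - assert (HF : Lip L (scheme sl su h n f)) by now apply Lip_scheme.
      destruct (mollify_cubic e L _ y He HF) as [p Hp].
      assert (H1 := PolyUp_cubic sl su Hsl Hsu h (u n) (u (S n)) y
        (mollify e (scheme sl su h n f) y + (2 * L * e + INR n * q)) p
        (mollify2 e (scheme sl su h n f) y) (L / e ^ 2) (HP n) Hh
        ltac:(apply Rdiv_le_0_compat; [assumption | nra])).
      specialize (H1 ltac:(intros z; specialize (Hp z); specialize (IH z);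
        apply Rabs_le_between in Hp; lra)).
      pose proof (smooth_step_lo _ y HF).
      pose proof (step_mollify_le sl su h e L _ y He HF).
      rewrite S_INR. simpl scheme. unfold q in *. lra. }
  specialize (K x).
  pose proof (mollify_near e L _ He (Lip_scheme sl su h n L f Hf) x) as M.
  apply Rabs_le_between in M. unfold scheme_err. fold q. lra.
Qed.

(** Here [step_mollify_le] points the wrong way, so [u] is mollified instead of the iterates. The
    hypothesis treats each extreme volatility separately: linear walks commute with mollification,
    and at each point one of the two realises [G]. The tolerance [eta] allows the number of substeps
    to depend on the accuracy. *)
Lemma scheme_lower (u : nat -> R -> R) n x : (forall k, Lip L (u k)) ->
  (forall k s eta, s = sl \/ s = su -> 0 < eta -> exists m, (1 <= m)%nat /\
     forall y, scheme s s (h / INR m) m (u k) y - eta <= u (S k) y) ->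
  scheme sl su h n (u 0%nat) x - scheme_err su L e h n <= u n x.
Proof.
  intros Hu HS. set (K := L / e ^ 2).
  assert (HL : 0 <= L) by now apply (Lip_nonneg L (u 0%nat)).
  assert (HK : 0 <= K) by (apply Rdiv_le_0_compat; [assumption | nra]).
  assert (H1 : forall k y s, s = sl \/ s = su ->
    mollify e (u k) y + h * (s ^ 2 / 2 * mollify2 e (u k) y) - kappa su * K * (h * sqrt h)
    <= mollify e (u (S k)) y).
  { intros k y s Hs. apply le_epsilon. intros eta Heta.
    destruct (HS k s eta Hs Heta) as [m [Hm Hle]].
    assert (Hm0 : 0 < INR m) by (apply lt_0_INR; lia).
    set (F := scheme s s (h / INR m) m (u k)) in *.
    assert (HF : Lip L F) by now apply Lip_scheme.
    assert (H2 : mollify e F y <= mollify e (u (S k)) y + eta).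
    { rewrite <- (mollify_addc e L) by auto.
      apply (mollify_le e L) with (M := L); auto.
      - intros a b. replace (u (S k) a + eta - (u (S k) b + eta)) with (u (S k) a - u (S k) b) by ring.
        apply Hu.
      - intros z. specialize (Hle z). lra. }
    unfold F in H2. rewrite <- (scheme_diag_mollify s _ m e L) in H2 by auto.
    assert (Hs0 : 0 <= s) by (destruct Hs; lra).
    destruct (mollify_cubic e L (u k) y He (Hu k)) as [p Hp].
    (* The [m] substeps count as a single step of length [h], so [m] does not enter the error. *)
    assert (H3 : PolyLo s s h (mollify e (u k)) (scheme s s (h / INR m) m (mollify e (u k)))).
    { replace h with (INR m * (h / INR m)) at 1 by (field; lra).
      apply PolyLo_scheme; try lra. apply Rdiv_le_0_compat; lra. }
    assert (H4 := PolyLo_cubic s s Hs0 (Rle_refl s) h _ _ y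
      (mollify e (u k) y) p (mollify2 e (u k) y) K H3 Hh HK).
    specialize (H4 ltac:(intros z; specialize (Hp z);
        apply Rabs_le_between in Hp; unfold K; lra)).
    rewrite Gfun_diag in H4.
    assert (kappa s * K * (h * sqrt h) <= kappa su * K * (h * sqrt h)).
    { apply Rmult_le_compat_r; [apply Rmult_le_pos; [lra | apply sqrt_pos]|].
      apply Rmult_le_compat_r; auto. apply kappa_le; destruct Hs; lra. }
    lra. }
  assert (H2 : forall k y,
    step sl su h (mollify e (u k)) y - 2 * kappa su * K * (h * sqrt h) <= mollify e (u (S k)) y).
  { intros k y. pose proof (smooth_step_up (u k) y (Hu k)) as U. fold K in U.
    destruct (Rle_dec 0 (mollify2 e (u k) y)).
    - rewrite Gfun_pos in U by lra. specialize (H1 k y su (or_intror eq_refl)). lra.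
    - rewrite Gfun_neg in U by lra. specialize (H1 k y sl (or_introl eq_refl)). lra. }
  assert (H3 : forall y, scheme sl su h n (mollify e (u 0%nat)) y
     <= mollify e (u n) y + INR n * (2 * kappa su * K * (h * sqrt h))).
  { induction n as [|n IH]; intros y; [simpl; lra|].
    change (scheme sl su h (S n) (mollify e (u 0%nat)) y)
      with (step sl su h (scheme sl su h n (mollify e (u 0%nat))) y).
    eapply Rle_trans; [apply step_le, IH|]. rewrite step_addc, S_INR.
    specialize (H2 n y). lra. }
  specialize (H3 x).
  pose proof (mollify_near e L _ He (Hu n) x) as M1. apply Rabs_le_between in M1.
  assert (M0 : scheme sl su h n (u 0%nat) x <= scheme sl su h n (mollify e (u 0%nat)) x + 2 * L * e).
  { apply scheme_le_addc. intros y.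
    pose proof (mollify_near e L _ He (Hu 0%nat) y) as M. apply Rabs_le_between in M. lra. }
  unfold scheme_err. fold K. lra.
Qed.

End Stability.

(** The index [S n] avoids dividing by [INR 0]. [Lim_seq] is total; for Lipschitz [f] the sequence
    does converge to a finite limit, by [heat_conv]. *)
Definition heat (sl su t : R) (f : R -> R) (x : R) : R :=
  real (Lim_seq (fun n => scheme sl su (t / INR (S n)) (S n) f x)).

Section Heat.
Variables (sl su : R).
Hypotheses (Hsl : 0 <= sl) (Hsu : sl <= su).

(** Fine iterates sampled at the coarse times satisfy the hypotheses of both [scheme_upper] and
    [scheme_lower]. The bound is uniform in the refinement factor [m]. *)
Lemma scheme_refine L f t eta : Lip L f -> 0 < t -> 0 < eta ->
  exists N, forall n m x, (N <= n)%nat -> (1 <= n)%nat -> (1 <= m)%nat ->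
    Rabs (scheme sl su (t / INR (n * m)) (n * m) f x - scheme sl su (t / INR n) n f x) <= eta.
Proof.
  intros Hf Ht Heta.
  destruct (scheme_err_small su L t eta (Lip_nonneg L f Hf) Ht Heta) as [N HN].
  exists N. intros n m x Hn Hn1 Hm. destruct (HN n Hn Hn1) as [e [He Herr]].
  assert (Hn0 : 0 < INR n) by (apply lt_0_INR; lia).
  assert (Hm0 : 0 < INR m) by (apply lt_0_INR; lia).
  set (h := t / INR n) in *. assert (Hh : 0 < h) by (apply Rdiv_lt_0_compat; lra).
  replace (t / INR (n * m)) with (h / INR m) by (rewrite mult_INR; unfold h; field; split; lra).
  set (u := fun k => scheme sl su (h / INR m) (k * m) f).
  assert (Hu : forall k, u (S k) = scheme sl su (h / INR m) m (u k)).
  { intros k. unfold u. simpl Nat.mul. apply scheme_add. }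
  assert (Hq : 0 <= h / INR m) by (apply Rdiv_le_0_compat; lra).
  assert (U : u n x <= scheme sl su h n f x + scheme_err su L e h n).
  { apply (scheme_upper sl su h L e Hsl Hsu Hh He f u); auto.
    - intros k. rewrite Hu. replace h with (INR m * (h / INR m)) at 1 by (field; lra).
      apply PolyUp_scheme; auto.
    - intros y. apply Rle_refl. }
  assert (D : scheme sl su h n (u 0%nat) x - scheme_err su L e h n <= u n x).
  { apply (scheme_lower sl su h L e Hsl Hsu Hh He u).
    - intros k. now apply Lip_scheme.
    - intros k s eps Hs Heps. exists m. split; auto. intros y. rewrite Hu.
      pose proof (scheme_diag_le sl su s (h / INR m) m (u k) y Hs). lra. }
  change (u 0%nat) with f in D. change (scheme sl su (h / INR m) (n * m) f x) with (u n x).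
  apply Rabs_le. lra.
Qed.

Lemma heat_conv L f t eta : Lip L f -> 0 < eta ->
  exists N, forall n x, (N <= n)%nat -> (1 <= n)%nat ->
    Rabs (scheme sl su (t / INR n) n f x - heat sl su t f x) <= eta.
Proof.
  intros Hf Heta.
  assert (HC : forall eps, 0 < eps -> exists N, forall n p x,
    (N <= n)%nat -> (N <= p)%nat -> (1 <= n)%nat -> (1 <= p)%nat ->
    Rabs (scheme sl su (t / INR n) n f x - scheme sl su (t / INR p) p f x) <= eps).
  { intros eps Heps. destruct (Rle_dec t 0) as [Ht|Ht].
    - exists 0%nat. intros n p x _ _ Hn Hp.
      assert (forall q, (1 <= q)%nat -> t / INR q <= 0).
      { intros q Hq. assert (0 < INR q) by (apply lt_0_INR; lia).
        assert (0 < / INR q) by now apply Rinv_0_lt_compat. unfold Rdiv. nra. }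
      rewrite !scheme_nonpos_time by auto. rewrite Rminus_diag, Rabs_R0. lra.
    - destruct (scheme_refine L f t (eps / 2) Hf ltac:(lra) ltac:(lra)) as [N HN].
      exists N. intros n p x Hn Hp Hn1 Hp1.
      (* Both schemes are compared with their common refinement into [n * p] steps. *)
      pose proof (HN n p x Hn Hn1 Hp1) as A. pose proof (HN p n x Hp Hp1 Hn1) as B.
      rewrite (Nat.mul_comm p n) in B.
      apply Rabs_le_between in A. apply Rabs_le_between in B. apply Rabs_le. lra. }
  assert (Hlim : forall x, is_lim_seq (fun n => scheme sl su (t / INR (S n)) (S n) f x) (heat sl su t f x)).
  { intros x. apply Lim_seq_correct'. apply ex_lim_seq_cauchy_corr.
    intros eps. destruct (HC (eps / 2)) as [N HN]; [destruct eps; simpl; lra|].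
    exists N. intros n p Hn Hp. specialize (HN (S n) (S p) x).
    eapply Rle_lt_trans; [apply HN; lia | destruct eps; simpl; lra]. }
  destruct (HC (eta / 2)) as [N HN]; [lra|]. exists N. intros n x Hn Hn1.
  specialize (Hlim x). apply is_lim_seq_spec in Hlim.
  destruct (Hlim (mkposreal (eta / 2) ltac:(lra))) as [M HM]. cbn [pos] in HM.
  specialize (HM (max M N) ltac:(lia)).
  specialize (HN n (S (max M N)) x Hn ltac:(lia) Hn1 ltac:(lia)).
  apply Rabs_le_between in HN. apply Rabs_lt_between in HM. apply Rabs_le. lra.
Qed.

(** The two times may differ, which the modulus of continuity in time exploits. *)
Lemma heat_ext_le L M f g t u c x : Lip L f -> Lip M g ->
  (forall n, (1 <= n)%nat -> scheme sl su (t / INR n) n f x <= scheme sl su (u / INR n) n g x + c) ->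
  heat sl su t f x <= heat sl su u g x + c.
Proof.
  intros Hf Hg H. apply le_epsilon. intros eps Heps.
  destruct (heat_conv L f t (eps / 2) Hf ltac:(lra)) as [N HN].
  destruct (heat_conv M g u (eps / 2) Hg ltac:(lra)) as [P HP].
  specialize (HN (S (max N P)) x ltac:(lia) ltac:(lia)).
  specialize (HP (S (max N P)) x ltac:(lia) ltac:(lia)).
  specialize (H (S (max N P)) ltac:(lia)).
  apply Rabs_le_between in HN. apply Rabs_le_between in HP. lra.
Qed.

End Heat.

(** * Quartic barriers for viscosity subsolutions *)

(** If the supremum [S] were not attained, each point of the rectangle would have a radius [delta]
    within which [F <= S - delta]. Compactness gives a positive lower bound for the radii of a
    cover, and this lowers the supremum. *)
Lemma max_attained_2d (F : R -> R -> R) a b c d B : a <= b -> c <= d ->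
  (forall t x, continuity_2d_pt F t x) -> (forall t x, a <= t <= b -> c <= x <= d -> F t x <= B) ->
  exists t0 x0, a <= t0 <= b /\ c <= x0 <= d /\
    forall t x, a <= t <= b -> c <= x <= d -> F t x <= F t0 x0.
Proof.
  intros Hab Hcd HF HB.
  destruct (completeness (fun z => exists t x, a <= t <= b /\ c <= x <= d /\ z = F t x)) as [S [HS1 HS2]].
  - exists B. intros z [t [x [Ht [Hx ->]]]]. auto.
  - exists (F a c), a, c. repeat split; lra.
  - apply NNPP. intros Hno.
    assert (Hlt : forall t x, a <= t <= b -> c <= x <= d -> F t x < S).
    { intros t x Ht Hx. destruct (Rlt_le_dec (F t x) S) as [|Hge]; auto.
      exfalso. apply Hno. exists t, x. repeat split; try lra.
      intros s y Hs Hy. apply Rle_trans with S; auto. apply HS1. exists s, y. auto. }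
    assert (HD : forall t x, exists delta : posreal, (a <= t <= b -> c <= x <= d ->
      forall s y, Rabs (s - t) < delta -> Rabs (y - x) < delta -> F s y <= S - delta)).
    { intros t x. destruct (excluded_middle_informative (a <= t <= b /\ c <= x <= d)) as [[Ht Hx]|Hout].
      - specialize (Hlt t x Ht Hx).
        destruct (HF t x (mkposreal ((S - F t x) / 2) ltac:(lra))) as [dl Hdl]. cbn [pos] in Hdl.
        assert (Hm : 0 < Rmin dl ((S - F t x) / 2)) by (apply Rmin_pos; [apply cond_pos | lra]).
        exists (mkposreal _ Hm). intros _ _ s y Hs Hy. cbn [pos] in *.
        pose proof (Rmin_l dl ((S - F t x) / 2)). pose proof (Rmin_r dl ((S - F t x) / 2)).
        specialize (Hdl s y ltac:(lra) ltac:(lra)). apply Rabs_lt_between in Hdl. lra.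
      - exists (mkposreal 1 Rlt_0_1). intros Ht Hx. exfalso. apply Hout. auto. }
    set (delta := fun t x => proj1_sig (constructive_indefinite_description _ (HD t x))).
    destruct (compactness_value_2d a b c d delta) as [m Hm].
    assert (HSm : S <= S - m).
    { apply HS2. intros z [t [x [Ht [Hx ->]]]]. apply NNPP. intros Hn.
      apply (Hm t x Ht Hx). intros [u [v [Hu [Hv [H1 [H2 H3]]]]]]. apply Hn.
      pose proof (proj2_sig (constructive_indefinite_description _ (HD u v)) Hu Hv t x H1 H2) as H4.
      change (F t x <= S - delta u v) in H4. lra. }
    pose proof (cond_pos m). lra.
Qed.

Lemma continuity_2d_pt_pow f n t x : continuity_2d_pt f t x ->
  continuity_2d_pt (fun u v => f u v ^ n) t x.
Proof.
  intros H. induction n as [|n IH]; simpl.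
  - apply continuity_2d_pt_const.
  - now apply continuity_2d_pt_mult.
Qed.

Ltac cont2 := repeat first
  [ apply continuity_2d_pt_const | apply continuity_2d_pt_id1 | apply continuity_2d_pt_id2
  | apply continuity_2d_pt_plus | apply continuity_2d_pt_minus | apply continuity_2d_pt_mult
  | apply continuity_2d_pt_pow ].

Lemma half_plane_continuity U t x eps : continuous_closed_half_plane U -> 0 <= t -> 0 < eps ->
  exists delta, 0 < delta /\ forall s y, 0 <= s -> Rabs (s - t) < delta -> Rabs (y - x) < delta ->
    Rabs (U s y - U t x) < eps.
Proof.
  intros HU Ht Heps. specialize (HU t x Ht).
  specialize (HU (ball (U t x) eps) (locally_ball _ (mkposreal eps Heps))).
  unfold filtermap, within in HU. destruct HU as [dl Hdl].
  exists dl. split; [apply cond_pos|]. intros s y Hs H1 H2.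
  apply (Hdl (s, y)); [split; assumption | assumption].
Qed.

(** Freezing [U] before [t0] gives a function continuous on the whole plane, as [max_attained_2d]
    asks, with the same values from [t0] on. *)
Lemma clamp_continuity U t0 t x : continuous_closed_half_plane U -> 0 <= t0 ->
  continuity_2d_pt (fun s y => U (Rmax t0 s) y) t x.
Proof.
  intros HU Ht0 eps.
  destruct (half_plane_continuity U (Rmax t0 t) x eps HU) as [dl [Hdl HH]].
  - pose proof (Rmax_l t0 t). lra.
  - apply cond_pos.
  - exists (mkposreal dl Hdl). intros s y Hs Hy. cbn [pos] in *. apply HH; auto.
    + pose proof (Rmax_l t0 s). lra.
    + eapply Rle_lt_trans; [|exact Hs]. unfold Rmax, Rabs.
      destruct (Rle_dec t0 s), (Rle_dec t0 t);
        repeat destruct (Rcase_abs _); lra.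
Qed.

(** The coefficients of [C] are the moments of a walk of volatility [su]: with
    [eta = 0], [w_t >= G (w_xx)]; [eta] makes this strict. *)
Definition barrier (sl su t0 x0 c p b C eta : R) (t x : R) : R :=
  c + p * (x - x0) + b / 2 * (x - x0) ^ 2 + (t - t0) * Gfun sl su b
  + C * ((x - x0) ^ 4 + 6 * su ^ 2 * (t - t0) * (x - x0) ^ 2 + 3 * su ^ 4 * (t - t0) ^ 2)
  + eta * ((t - t0) + (t - t0) ^ 2).

Section Barrier.
Variables (sl su t0 x0 c p b C eta : R).
Let w := barrier sl su t0 x0 c p b C eta.

Lemma barrier_Dt : Dt w = fun t x => Gfun sl su b
  + C * (6 * su ^ 2 * (x - x0) ^ 2 + 6 * su ^ 4 * (t - t0)) + eta * (1 + 2 * (t - t0)).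
Proof.
  extensionality t. extensionality x. apply is_derive_unique. unfold w, barrier.
  auto_derive; [trivial|]. simpl. field.
Qed.

Lemma barrier_Dx : Defs.Dx w = fun t x => p + b * (x - x0)
  + C * (4 * (x - x0) ^ 3 + 12 * su ^ 2 * (t - t0) * (x - x0)).
Proof.
  extensionality t. extensionality x. apply is_derive_unique. unfold w, barrier.
  auto_derive; [trivial|]. simpl. field.
Qed.

Lemma barrier_Dxx : Dxx w = fun t x => b
  + C * (12 * (x - x0) ^ 2 + 12 * su ^ 2 * (t - t0)).
Proof.
  extensionality t. extensionality x. unfold Dxx. rewrite barrier_Dx.
  apply is_derive_unique. auto_derive; [trivial|]. simpl. field.
Qed.

Lemma barrier_C12 : C12 w.
Proof.
  intros t x _. rewrite barrier_Dxx, barrier_Dt, barrier_Dx.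
  repeat split; try (unfold w, barrier; cont2).
  - unfold w, barrier. auto_derive. trivial.
  - unfold w, barrier. auto_derive. trivial.
  - auto_derive. trivial.
Qed.

End Barrier.

(** Two completed squares, [(z + p / 2) ^ 2] and [(C * z ^ 2 + (b - 2)) ^ 2 / (4 * C)]. This makes
    the barrier coercive in space. *)
Lemma coercive_lower_bound C p b z : 0 < C ->
  3 * C / 4 * z ^ 4 - (p ^ 2 / 4 + (b - 2) ^ 2 / (4 * C)) <= p * z + b / 2 * z ^ 2 + C * z ^ 4.
Proof.
  intros HC.
  assert (E : p * z + b / 2 * z ^ 2 + C * z ^ 4 -
    (3 * C / 4 * z ^ 4 - (p ^ 2 / 4 + (b - 2) ^ 2 / (4 * C)))
    = (z + p / 2) ^ 2 + (C * z ^ 2 + (b - 2)) ^ 2 / (4 * C)) by (field; lra).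
  pose proof (pow2_ge_0 (z + p / 2)).
  assert (0 <= (C * z ^ 2 + (b - 2)) ^ 2 / (4 * C))
    by (apply Rdiv_le_0_compat; [apply pow2_ge_0 | lra]).
  lra.
Qed.

Section Comparison.
Variables (sl su : R) (U : R -> R -> R).
Hypotheses (Hsl : 0 <= sl) (Hsu : sl <= su).
Hypotheses (HUb : bounded_closed_half_plane U) (HUc : continuous_closed_half_plane U)
  (HU : viscosity_subsolution (Gfun sl su) U).

(** [U - w] reaches its maximum over all times [s >= t0]. At a later time the strictness of the
    barrier contradicts the subsolution property, so the maximum lies at [t0], where it is at most
    0. The term [eta * (t - t0) ^ 2] confines the maximum in time: with no terminal time, every
    maximum after [t0] has the two-sided neighbourhood that the definition of subsolution
    demands. *)
Lemma barrier_comparison t0 x0 c p b C eta t x : 0 <= t0 -> t0 <= t -> 0 < C -> 0 < eta ->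
  (forall y, U t0 y <= c + p * (y - x0) + b / 2 * (y - x0) ^ 2 + C * (y - x0) ^ 4) ->
  U t x <= barrier sl su t0 x0 c p b C eta t x.
Proof.
  intros Ht0 Ht HC Heta H0. destruct HUb as [M HM].
  set (w := barrier sl su t0 x0 c p b C eta).
  set (F := fun s y => U (Rmax t0 s) y - w s y).
  assert (HFc : forall s y, continuity_2d_pt F s y).
  { intros s y. apply continuity_2d_pt_minus; [now apply clamp_continuity|].
    unfold w, barrier. cont2. }
  set (g := Gfun sl su b).
  set (D := p ^ 2 / 4 + (b - 2) ^ 2 / (4 * C)).
  assert (Hw : forall s y, t0 <= s ->
    c - D - g ^ 2 / (2 * eta) + 3 * C / 4 * (y - x0) ^ 4 + eta / 2 * (s - t0) ^ 2 <= w s y).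
  { intros s y Hs. unfold w, barrier. fold g.
    pose proof (coercive_lower_bound C p b (y - x0) HC) as H1. fold D in H1.
    (* [g] may be negative: half of the quadratic time term is spent on [(s - t0) * g]. *)
    assert (H2 : (s - t0) * g + eta * (s - t0) ^ 2 -
       (eta / 2 * (s - t0) ^ 2 - g ^ 2 / (2 * eta)) = (eta * (s - t0) + g) ^ 2 / (2 * eta)) by (field; lra).
    assert (H3 : 0 <= (eta * (s - t0) + g) ^ 2 / (2 * eta))
      by (apply Rdiv_le_0_compat; [apply pow2_ge_0 | lra]).
    assert (H4 : 0 <= C * (6 * su ^ 2 * (s - t0) * (y - x0) ^ 2 + 3 * su ^ 4 * (s - t0) ^ 2)).
    { apply Rmult_le_pos; [lra|]. pose proof (pow2_ge_0 (y - x0)). pose proof (pow2_ge_0 (s - t0)).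
      pose proof (pow2_ge_0 su). pose proof (pow_le su 4 ltac:(lra)).
      apply Rplus_le_le_0_compat; [apply Rmult_le_pos; [apply Rmult_le_pos|]|apply Rmult_le_pos]; lra. }
    assert (0 <= eta * (s - t0)) by (apply Rmult_le_pos; lra).
    lra. }
  set (v0 := F t0 x0).
  (* Once the coercive terms exceed [Q], [F] is at most its value at [(t0, x0)]. The radius [r] and
     the duration [T] ensure this outside a box; both are at least 1, so higher powers dominate the
     first power there. *)
  set (Q := M - v0 - c + D + g ^ 2 / (2 * eta)).
  set (r := 1 + (Rabs Q + 1) * (4 / (3 * C))).
  set (T := 1 + (Rabs Q + 1) * (2 / eta)).
  assert (HQ : 0 <= Rabs Q) by apply Rabs_pos.
  assert (HQ' : Q <= Rabs Q) by apply Rle_abs.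
  assert (Hr0 : 0 < (Rabs Q + 1) * (4 / (3 * C)))
    by (apply Rmult_lt_0_compat; [lra | apply Rdiv_lt_0_compat; lra]).
  assert (HT0 : 0 < (Rabs Q + 1) * (2 / eta))
    by (apply Rmult_lt_0_compat; [lra | apply Rdiv_lt_0_compat; lra]).
  assert (Hup : forall s y, t0 <= s -> F s y <= M - w s y).
  { intros s y Hs. unfold F. rewrite Rmax_right by lra.
    specialize (HM s y ltac:(lra)). apply Rabs_le_between in HM. lra. }
  assert (Hout : forall s y, t0 <= s -> (r < Rabs (y - x0) \/ T < s - t0) -> F s y <= v0).
  { intros s y Hs Ho. specialize (Hup s y Hs). specialize (Hw s y Hs).
    assert (Hz4 : 0 <= (y - x0) ^ 4) by (replace ((y - x0) ^ 4) with (((y - x0) ^ 2) ^ 2) by ring; apply pow2_ge_0).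
    pose proof (pow2_ge_0 (s - t0)) as Hs2.
    assert (Q <= 3 * C / 4 * (y - x0) ^ 4 + eta / 2 * (s - t0) ^ 2).
    { destruct Ho as [Ho|Ho].
      - assert (Hz : r <= (y - x0) ^ 4).
        { assert (H2 : (y - x0) ^ 2 = Rabs (y - x0) ^ 2)
            by (rewrite RPow_abs; symmetry; apply Rabs_pos_eq, pow2_ge_0).
          replace ((y - x0) ^ 4) with ((y - x0) ^ 2 * (y - x0) ^ 2) by ring. rewrite H2.
          assert (1 <= r) by (unfold r; lra).
          assert (Rabs (y - x0) <= Rabs (y - x0) ^ 2) by nra. nra. }
        apply (Rmult_le_compat_l (3 * C / 4)) in Hz; [|lra].
        replace (3 * C / 4 * r) with (3 * C / 4 + (Rabs Q + 1)) in Hz by (unfold r; field; lra).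
        assert (0 <= eta / 2 * (s - t0) ^ 2) by (apply Rmult_le_pos; lra). lra.
      - assert (Hz : T <= (s - t0) ^ 2) by (assert (1 <= T) by (unfold T; lra); nra).
        apply (Rmult_le_compat_l (eta / 2)) in Hz; [|lra].
        replace (eta / 2 * T) with (eta / 2 + (Rabs Q + 1)) in Hz by (unfold T; field; lra).
        assert (0 <= 3 * C / 4 * (y - x0) ^ 4) by (apply Rmult_le_pos; lra). lra. }
    unfold Q in *. lra. }
  destruct (max_attained_2d F t0 (t0 + T) (x0 - r) (x0 + r)
    (M - (c - D - g ^ 2 / (2 * eta)))) as [s [y [Hs [Hy Hmax]]]].
  - unfold T. lra.
  - unfold r. lra.
  - exact HFc.
  - intros s y Hs _. specialize (Hup s y ltac:(lra)). specialize (Hw s y ltac:(lra)).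
    assert (Hz4 : 0 <= (y - x0) ^ 4) by (replace ((y - x0) ^ 4) with (((y - x0) ^ 2) ^ 2) by ring; apply pow2_ge_0).
    assert (0 <= 3 * C / 4 * (y - x0) ^ 4) by (apply Rmult_le_pos; lra).
    assert (0 <= eta / 2 * (s - t0) ^ 2) by (apply Rmult_le_pos; [lra | apply pow2_ge_0]). lra.
  - assert (Hglob : forall s' y', t0 <= s' -> F s' y' <= F s y).
    { intros s' y' Hs'. destruct (Rle_lt_dec (Rabs (y' - x0)) r) as [H1|H1].
      - destruct (Rle_lt_dec (s' - t0) T) as [H2|H2].
        + apply Hmax; [lra|]. apply Rabs_le_between in H1. lra.
        + apply Rle_trans with v0; [apply Hout; auto|]. apply Hmax; unfold T, r; lra.
      - apply Rle_trans with v0; [apply Hout; auto|]. apply Hmax; unfold T, r; lra. }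
    assert (Hgoal : F s y <= 0).
    { destruct (Rle_lt_dec s t0) as [Hst|Hst].
      - replace s with t0 by lra. unfold F, w, barrier. rewrite Rmax_left, Rminus_diag by lra.
        specialize (H0 y). nra.
      - exfalso. assert (Hv := HU w s y ltac:(lra) (barrier_C12 _ _ _ _ _ _ _ _ _)).
        assert (Hloc : locally_2d (fun s' y' => U s' y' - w s' y' <= U s y - w s y) s y).
        { exists (mkposreal (s - t0) ltac:(lra)). intros s' y' H1 _. cbn [pos] in H1.
          apply Rabs_lt_between in H1. specialize (Hglob s' y' ltac:(lra)).
          unfold F in Hglob. rewrite !Rmax_right in Hglob by lra. exact Hglob. }
        specialize (Hv Hloc). unfold w in Hv. rewrite barrier_Dt, barrier_Dxx in Hv.
        assert (Hz2 := pow2_ge_0 (y - x0)). assert (Hsu2 := pow2_ge_0 su).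
        assert (HB : 0 <= C * (12 * (y - x0) ^ 2 + 12 * su ^ 2 * (s - t0))).
        { apply Rmult_le_pos; [lra|]. apply Rplus_le_le_0_compat; [lra|].
          apply Rmult_le_pos; lra. }
        pose proof (Gfun_add_le sl su b _ Hsl Hsu HB) as HG.
        (* This is exactly the time derivative of the [C] terms of the barrier, so only the positive
           [eta] terms are left. *)
        replace (su ^ 2 / 2 * (C * (12 * (y - x0) ^ 2 + 12 * su ^ 2 * (s - t0))))
          with (C * (6 * su ^ 2 * (y - x0) ^ 2 + 6 * su ^ 4 * (s - t0))) in HG by field.
        assert (0 < eta * (1 + 2 * (s - t0))) by (apply Rmult_lt_0_compat; lra).
        lra. }
    specialize (Hglob t x Ht). unfold F in Hglob at 1. rewrite Rmax_right in Hglob by lra.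
    fold w. lra.
Qed.

(** [C] may be 0, while [barrier_comparison] wants positive [C] and [eta]. Both are raised by
    [eps / q], where [q] collects their coefficients at [(t0 + h, x)]; the excess is then exactly
    [eps]. *)
Lemma PolyUp_viscosity t0 h : 0 <= t0 -> 0 < h -> PolyUp sl su h (U t0) (U (t0 + h)).
Proof.
  intros Ht0 Hh x c p b C HC Hf.
  set (q := 3 * su ^ 4 * h ^ 2 + (h + h ^ 2)).
  assert (Hq : 0 < q).
  { unfold q. pose proof (pow_le su 4 ltac:(lra)). pose proof (pow2_ge_0 h).
    assert (0 <= 3 * su ^ 4 * h ^ 2) by (apply Rmult_le_pos; lra). lra. }
  apply le_epsilon. intros eps Heps.
  assert (He : 0 < eps / q) by (apply Rdiv_lt_0_compat; lra).
  assert (K : U (t0 + h) x <= barrier sl su t0 x c p b (C + eps / q) (eps / q) (t0 + h) x).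
  { apply barrier_comparison; try lra. intros y. specialize (Hf y).
    assert (0 <= eps / q * (y - x) ^ 4).
    { apply Rmult_le_pos; [lra|]. replace ((y - x) ^ 4) with (((y - x) ^ 2) ^ 2) by ring.
      apply pow2_ge_0. }
    lra. }
  unfold barrier in K. replace (t0 + h - t0) with h in K by ring. rewrite Rminus_diag in K.
  assert (E : eps / q * q = eps) by (field; lra).
  set (d := eps / q) in *. clearbody d. unfold q in E.
  eapply Rle_trans; [exact K|]. rewrite <- E. right. ring.
Qed.

End Comparison.

(** * Comparison with viscosity solutions *)

Definition opp2 (u : R -> R -> R) (t x : R) : R := - u t x.

Lemma Dt_opp psi t x : Dt (opp2 psi) t x = - Dt psi t x.
Proof. unfold Dt, opp2. apply Derive_opp. Qed.

Lemma Dx_opp psi t x : Defs.Dx (opp2 psi) t x = - Defs.Dx psi t x.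
Proof. unfold Defs.Dx, opp2. apply Derive_opp. Qed.

Lemma Dxx_opp psi t x : Dxx (opp2 psi) t x = - Dxx psi t x.
Proof.
  unfold Dxx. rewrite (functional_extensionality _ _ (Dx_opp psi t)). apply Derive_opp.
Qed.

Lemma C12_opp psi : C12 psi -> C12 (opp2 psi).
Proof.
  intros H t x Ht. destruct (H t x Ht) as [H1 [H2 [H3 [H4 [H5 [H6 H7]]]]]].
  repeat split.
  - apply (ex_derive_opp (fun s => psi s x)), H1.
  - apply (ex_derive_opp (psi t)), H2.
  - rewrite (functional_extensionality _ _ (Dx_opp psi t)).
    apply (ex_derive_opp (Defs.Dx psi t)), H3.
  - now apply continuity_2d_pt_opp.
  - apply continuity_2d_pt_ext with (fun u v => - Dt psi u v);
      [intros; symmetry; apply Dt_opp | now apply continuity_2d_pt_opp].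
  - apply continuity_2d_pt_ext with (fun u v => - Defs.Dx psi u v);
      [intros; symmetry; apply Dx_opp | now apply continuity_2d_pt_opp].
  - apply continuity_2d_pt_ext with (fun u v => - Dxx psi u v);
      [intros; symmetry; apply Dxx_opp | now apply continuity_2d_pt_opp].
Qed.

Lemma viscosity_sub_opp G u : viscosity_supersolution G u ->
  viscosity_subsolution (fun a => - G (- a)) (opp2 u).
Proof.
  intros H psi t x Ht Hpsi Hloc.
  specialize (H (opp2 psi) t x Ht (C12_opp psi Hpsi)).
  rewrite Dt_opp, Dxx_opp in H. enough (- Dt psi t x - G (- Dxx psi t x) >= 0) by lra.
  apply H. revert Hloc. apply locally_2d_impl, locally_2d_forall.
  intros s y. unfold opp2. lra.
Qed.

Lemma viscosity_super_of_opp G u : viscosity_subsolution (fun a => - G (- a)) (opp2 u) ->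
  viscosity_supersolution G u.
Proof.
  intros H psi t x Ht Hpsi Hloc.
  specialize (H (opp2 psi) t x Ht (C12_opp psi Hpsi)).
  rewrite Dt_opp, Dxx_opp, Ropp_involutive in H.
  enough (- Dt psi t x - - G (Dxx psi t x) <= 0) by lra.
  apply H. revert Hloc. apply locally_2d_impl, locally_2d_forall.
  intros s y. unfold opp2. lra.
Qed.

Lemma viscosity_sub_mono G1 G2 u : (forall a, G1 a <= G2 a) ->
  viscosity_subsolution G1 u -> viscosity_subsolution G2 u.
Proof.
  intros HG H psi t x Ht Hpsi Hloc. specialize (H psi t x Ht Hpsi Hloc).
  specialize (HG (Dxx psi t x)). lra.
Qed.

Lemma bounded_opp u : bounded_closed_half_plane u -> bounded_closed_half_plane (opp2 u).
Proof.
  intros [M HM]. exists M. intros t x Ht. unfold opp2. rewrite Rabs_Ropp. auto.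
Qed.

Lemma continuous_closed_opp u :
  continuous_closed_half_plane u -> continuous_closed_half_plane (opp2 u).
Proof.
  intros H t x Ht. specialize (H t x Ht). unfold opp2.
  eapply filterlim_comp; [exact H|]. apply (filterlim_opp (u t x)).
Qed.

Section Uniqueness.
Variables (sl su : R).
Hypotheses (Hsl : 0 <= sl) (Hsu : sl <= su).

(** Stated with the scheme and not its limit, because [heat_le_supersolution] feeds a finite number
    of linear substeps to [scheme_lower]. *)
Lemma subsolution_le_scheme U L f t0 t eta :
  bounded_closed_half_plane U -> continuous_closed_half_plane U ->
  viscosity_subsolution (Gfun sl su) U ->
  0 <= t0 -> 0 < t -> Lip L f -> (forall y, U t0 y <= f y) -> 0 < eta ->
  exists N, forall n x, (N <= n)%nat -> (1 <= n)%nat ->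
    U (t0 + t) x <= scheme sl su (t / INR n) n f x + eta.
Proof.
  intros HUb HUc HU Ht0 Ht Hf H0 Heta.
  destruct (scheme_err_small su L t eta (Lip_nonneg L f Hf) Ht Heta) as [N HN].
  exists N. intros n x Hn Hn1. destruct (HN n Hn Hn1) as [e [He Herr]].
  assert (Hn0 : 0 < INR n) by (apply lt_0_INR; lia).
  set (h := t / INR n) in *. assert (Hh : 0 < h) by (apply Rdiv_lt_0_compat; lra).
  set (u := fun k => U (t0 + INR k * h)).
  assert (K : u n x <= scheme sl su h n f x + scheme_err su L e h n).
  { apply (scheme_upper sl su h L e Hsl Hsu Hh He f u); auto.
    - intros k. unfold u.
      replace (t0 + INR (S k) * h) with ((t0 + INR k * h) + h) by (rewrite S_INR; ring).
      apply PolyUp_viscosity; auto. pose proof (pos_INR k). nra.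
    - intros y. unfold u. simpl. replace (t0 + 0 * h) with t0 by ring. apply H0. }
  unfold u in K. replace (INR n * h) with t in K by (unfold h; field; lra). lra.
Qed.

Lemma subsolution_le_heat U L f t0 t x :
  bounded_closed_half_plane U -> continuous_closed_half_plane U ->
  viscosity_subsolution (Gfun sl su) U ->
  0 <= t0 -> 0 < t -> Lip L f -> (forall y, U t0 y <= f y) ->
  U (t0 + t) x <= heat sl su t f x.
Proof.
  intros HUb HUc HU Ht0 Ht Hf H0. apply le_epsilon. intros eps Heps.
  destruct (subsolution_le_scheme U L f t0 t (eps / 2) HUb HUc HU Ht0 Ht Hf H0) as [N HN]; [lra|].
  destruct (heat_conv sl su Hsl Hsu L f t (eps / 2) Hf) as [P HP]; [lra|].
  specialize (HN (S (max N P)) x ltac:(lia) ltac:(lia)).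
  specialize (HP (S (max N P)) x ltac:(lia) ltac:(lia)).
  apply Rabs_le_between in HP. lra.
Qed.

End Uniqueness.

(** A supremum of [L]-Lipschitz functions is again [L]-Lipschitz, and the lower bound of [g]
    supplies a first member of the family. The slices of a supersolution come with no Lipschitz
    bound, whereas [scheme_lower] requires a common one. *)
Lemma lipschitz_minorant L g : 0 <= L -> (exists M, forall x, M <= g x) ->
  exists m, Lip L m /\ (forall x, m x <= g x) /\
    forall k, Lip L k -> (forall x, k x <= g x) -> forall x, k x <= m x.
Proof.
  intros HL [M HM].
  set (E := fun x z => exists k, Lip L k /\ (forall y, k y <= g y) /\ z = k x).
  assert (HE : forall x, { z | is_lub (E x) z }).
  { intros x. apply completeness.
    - exists (g x). intros z [k [_ [Hk ->]]]. apply Hk.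
    - exists M, (fun _ => M). repeat split; auto.
      intros a b. rewrite Rminus_diag, Rabs_R0. apply Rmult_le_pos; [lra | apply Rabs_pos]. }
  exists (fun x => proj1_sig (HE x)). split; [|split].
  - assert (K : forall x y, proj1_sig (HE x) <= proj1_sig (HE y) + L * Rabs (x - y)).
    { intros x y. destruct (HE x) as [z [Hz1 Hz2]], (HE y) as [w [Hw1 Hw2]]. cbn [proj1_sig].
      apply Hz2. intros v [k [HkL [Hk ->]]].
      assert (k y <= w) by (apply Hw1; exists k; auto).
      specialize (HkL x y). pose proof (Rle_abs (k x - k y)). lra. }
    intros x y. pose proof (K x y). pose proof (K y x). rewrite (Rabs_minus_sym y x) in *.
    apply Rabs_le. lra.
  - intros x. destruct (HE x) as [z [Hz1 Hz2]]. cbn [proj1_sig].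
    apply Hz2. intros v [k [_ [Hk ->]]]. apply Hk.
  - intros k HkL Hk x. destruct (HE x) as [z [Hz1 Hz2]]. cbn [proj1_sig].
    apply Hz1. exists k. auto.
Qed.

Lemma Lip_opp L f : Lip L f -> Lip L (fun y => - f y).
Proof.
  intros H x y. replace (- f x - - f y) with (- (f x - f y)) by ring.
  rewrite Rabs_Ropp. apply H.
Qed.

(** [V] is a supersolution of each constant-volatility heat equation, and the
    linear scheme preserves Lipschitz constants, so the largest Lipschitz
    minorants of the slices of [V] dominate the linear schemes started from
    one another. *)
Lemma heat_le_supersolution sl su V L f t0 t x : 0 <= sl -> sl <= su ->
  bounded_closed_half_plane V -> continuous_closed_half_plane V ->
  viscosity_supersolution (Gfun sl su) V ->
  0 <= t0 -> 0 < t -> Lip L f -> (forall y, f y <= V t0 y) ->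
  heat sl su t f x <= V (t0 + t) x.
Proof.
  intros Hsl Hsu HVb HVc HV Ht0 Ht Hf H0. apply le_epsilon. intros eps Heps.
  assert (HL := Lip_nonneg L f Hf).
  destruct (scheme_err_small su L t (eps / 2) HL Ht) as [N HN]; [lra|].
  destruct (heat_conv sl su Hsl Hsu L f t (eps / 2) Hf) as [P HP]; [lra|].
  set (n := S (max N P)).
  specialize (HP n x ltac:(lia) ltac:(lia)). apply Rabs_le_between in HP.
  destruct (HN n ltac:(lia) ltac:(lia)) as [e [He Herr]].
  assert (Hn0 : 0 < INR n) by (apply lt_0_INR; lia).
  set (h := t / INR n) in *. assert (Hh : 0 < h) by (apply Rdiv_lt_0_compat; lra).
  assert (HM : forall k : nat, exists m, Lip L m /\ (forall x, m x <= V (t0 + INR k * h) x) /\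
    forall k', Lip L k' -> (forall x, k' x <= V (t0 + INR k * h) x) -> forall x, k' x <= m x).
  { intros k. apply lipschitz_minorant; auto. destruct HVb as [M HM]. exists (- M). intros y.
    pose proof (pos_INR k). specialize (HM (t0 + INR k * h) y ltac:(nra)).
    apply Rabs_le_between in HM. lra. }
  set (u := fun k => proj1_sig (constructive_indefinite_description _ (HM k))).
  assert (Hu : forall k, Lip L (u k) /\ (forall x, u k x <= V (t0 + INR k * h) x) /\
    forall k', Lip L k' -> (forall x, k' x <= V (t0 + INR k * h) x) -> forall x, k' x <= u k x)
    by (intros k; exact (proj2_sig (constructive_indefinite_description _ (HM k)))).
  assert (K : scheme sl su h n (u 0%nat) x - scheme_err su L e h n <= u n x).
  { apply (scheme_lower sl su h L e Hsl Hsu Hh He u).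
    - intros k. apply Hu.
    - intros k s eta Hs Heta. destruct (Hu k) as [HuL [HuV _]].
      assert (Hs0 : 0 <= s) by (destruct Hs; lra).
      (* Since [G] dominates each constant-volatility operator, [opp2 V] is a subsolution of the
         linear equation with volatility [s]. *)
      assert (HG : forall a, - Gfun sl su (- a) <= Gfun s s a).
      { intros a. rewrite Gfun_diag.
        pose proof (Gfun_ge sl su s (- a) Hsl ltac:(destruct Hs; lra) ltac:(destruct Hs; lra)). lra. }
      assert (Htk : 0 <= t0 + INR k * h) by (pose proof (pos_INR k); nra).
      destruct (subsolution_le_scheme s s Hs0 (Rle_refl s) (opp2 V) L (fun y => - u k y)
        (t0 + INR k * h) h eta (bounded_opp V HVb) (continuous_closed_opp V HVc)
        (viscosity_sub_mono _ _ _ HG (viscosity_sub_opp _ _ HV)) Htk Hh (Lip_opp L _ HuL))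
        as [Q HQ]; auto.
      { intros y. unfold opp2. specialize (HuV y). lra. }
      exists (S Q). split; [lia|]. intros y.
      (* Lowered by [eta], the linear scheme is an [L]-Lipschitz function below the next slice,
         hence below the greatest such minorant. *)
      assert (Hk : forall z, scheme s s (h / INR (S Q)) (S Q) (u k) z + - eta <= u (S k) z).
      { apply Hu.
        - intros a b. replace (scheme s s (h / INR (S Q)) (S Q) (u k) a + - eta -
            (scheme s s (h / INR (S Q)) (S Q) (u k) b + - eta)) with
            (scheme s s (h / INR (S Q)) (S Q) (u k) a - scheme s s (h / INR (S Q)) (S Q) (u k) b) by ring.
          now apply Lip_scheme.
        - intros z. specialize (HQ (S Q) z ltac:(lia) ltac:(lia)).
          rewrite scheme_diag_opp in HQ. unfold opp2 in HQ.
          replace (t0 + INR (S k) * h) with (t0 + INR k * h + h) by (rewrite S_INR; ring). lra. }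
      specialize (Hk y). lra. }
  assert (K0 : scheme sl su h n f x <= scheme sl su h n (u 0%nat) x).
  { apply scheme_le. apply Hu; auto. intros y. simpl. replace (t0 + 0 * h) with t0 by ring. auto. }
  destruct (Hu n) as [_ [HuV _]]. specialize (HuV x).
  replace (t0 + INR n * h) with (t0 + t) in HuV by (unfold h; field; lra). lra.
Qed.

(** * Order, regularity and one-step bounds of the limit operator *)

Section HeatProps.
Variables (sl su : R).
Hypotheses (Hsl : 0 <= sl) (Hsu : sl <= su).

Lemma heat_nonpos_time L f t x : Lip L f -> t <= 0 -> heat sl su t f x = f x.
Proof.
  intros Hf Ht. apply cond_eq. intros eps Heps.
  destruct (heat_conv sl su Hsl Hsu L f t (eps / 2) Hf) as [N HN]; [lra|].
  specialize (HN (S N) x ltac:(lia) ltac:(lia)).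
  rewrite scheme_nonpos_time in HN.
  - rewrite Rabs_minus_sym. lra.
  - assert (0 < / INR (S N)) by (apply Rinv_0_lt_compat, lt_0_INR; lia). unfold Rdiv. nra.
Qed.

Lemma heat_le_addc L M f g t c x : Lip L f -> Lip M g -> (forall y, f y <= g y + c) ->
  heat sl su t f x <= heat sl su t g x + c.
Proof.
  intros Hf Hg H. apply (heat_ext_le sl su Hsl Hsu L M); auto.
  intros n _. now apply scheme_le_addc.
Qed.

Lemma heat_le L M f g t x : Lip L f -> Lip M g -> (forall y, f y <= g y) ->
  heat sl su t f x <= heat sl su t g x.
Proof.
  intros Hf Hg H. rewrite <- (Rplus_0_r (heat sl su t g x)).
  apply (heat_le_addc L M); auto. intros y. specialize (H y). lra.
Qed.

Lemma heat_const t c x : heat sl su t (fun _ => c) x = c.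
Proof.
  unfold heat. rewrite (Lim_seq_ext _ (fun _ => c)); [now rewrite Lim_seq_const|].
  intros n. apply scheme_const.
Qed.

Lemma Lip_const c : Lip 0 (fun _ => c).
Proof. intros x y. rewrite Rminus_diag, Rabs_R0. lra. Qed.

Lemma heat_bound L f t M x : Lip L f -> (forall y, Rabs (f y) <= M) ->
  Rabs (heat sl su t f x) <= M.
Proof.
  intros Hf HM.
  assert (heat sl su t f x <= M).
  { rewrite <- (heat_const t M x). apply (heat_le L 0); auto using Lip_const.
    intros y. specialize (HM y). apply Rabs_le_between in HM. lra. }
  assert (- M <= heat sl su t f x).
  { rewrite <- (heat_const t (- M) x). apply (heat_le 0 L); auto using Lip_const.
    intros y. specialize (HM y). apply Rabs_le_between in HM. lra. }
  apply Rabs_le. lra.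
Qed.

Lemma heat_transl f t c x : heat sl su t (fun y => f (c + y)) x = heat sl su t f (c + x).
Proof. unfold heat. f_equal. apply Lim_seq_ext. intros n. apply scheme_transl. Qed.

Lemma Lip_transl L f c : Lip L f -> Lip L (fun y => f (c + y)).
Proof.
  intros H x y. replace (x - y) with (c + x - (c + y)) by ring. apply H.
Qed.

Lemma Lip_heat L f t : Lip L f -> Lip L (heat sl su t f).
Proof.
  intros Hf.
  assert (K : forall x y, heat sl su t f x <= heat sl su t f y + L * Rabs (x - y)).
  { intros x y. replace x with ((x - y) + y) at 1 by ring. rewrite <- heat_transl.
    apply (heat_le_addc L L); auto using Lip_transl.
    intros z. specialize (Hf (x - y + z) z). replace (x - y + z - z) with (x - y) in Hf by ring.
    pose proof (Rle_abs (f (x - y + z) - f z)). lra. }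
  intros x y. pose proof (K x y). pose proof (K y x). rewrite (Rabs_minus_sym y x) in *.
  apply Rabs_le. lra.
Qed.


Lemma heat_scal f t c x : 0 <= c ->
  heat sl su t (fun y => c * f y) x = c * heat sl su t f x.
Proof.
  intros Hc. unfold heat.
  rewrite (Lim_seq_ext _ (fun n => c * scheme sl su (t / INR (S n)) (S n) f x))
    by (intros n; now apply scheme_scal).
  rewrite Lim_seq_scal_l. now destruct (Lim_seq _) as [r| |]; simpl;
    [| destruct (Rle_dec 0 c) as [H|H]; [destruct (Rle_lt_or_eq_dec 0 c H)|] ..]; simpl; lra.
Qed.

Lemma scheme_unit_time f t n x : 0 <= t -> (1 <= n)%nat ->
  scheme sl su (t / INR n) n f x = scheme sl su (1 / INR n) n (fun y => f (x + sqrt t * y)) 0.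
Proof.
  intros Ht Hn. assert (Hn0 : 0 < INR n) by (apply lt_0_INR; lia).
  rewrite <- (scheme_rescale sl su (sqrt t) (1 / INR n) n (fun z => f (x + z)) 0).
  - rewrite Rmult_0_r, scheme_transl, Rplus_0_r, pow2_sqrt by auto.
    f_equal. field. lra.
  - apply sqrt_pos.
  - apply Rdiv_le_0_compat; lra.
Qed.

(** After scaling to unit time the two data differ by at most [q * Rabs y]. The inequality
    [Rabs y <= (1 + y ^ 2) / 2] turns this into a quadratic, whose evolution [PolyUp_scheme]
    controls with [C = 0]. *)
Lemma heat_time_modulus L f t u x : Lip L f -> 0 <= t -> 0 <= u ->
  heat sl su t f x <= heat sl su u f x + L * Rabs (sqrt t - sqrt u) * ((1 + su ^ 2) / 2).
Proof.
  intros Hf Ht Hu. apply (heat_ext_le sl su Hsl Hsu L L); auto. intros n Hn.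
  assert (Hn0 : 0 < INR n) by (apply lt_0_INR; lia).
  rewrite (scheme_unit_time f t), (scheme_unit_time f u) by auto.
  set (q := L * Rabs (sqrt t - sqrt u)).
  assert (Hq : 0 <= q) by (apply Rmult_le_pos; [now apply (Lip_nonneg L f) | apply Rabs_pos]).
  apply Rle_trans with (scheme sl su (1 / INR n) n (fun y => f (x + sqrt u * y) + q / 2 * (1 + y ^ 2)) 0).
  - apply scheme_le. intros y. specialize (Hf (x + sqrt t * y) (x + sqrt u * y)).
    replace (x + sqrt t * y - (x + sqrt u * y)) with ((sqrt t - sqrt u) * y) in Hf by ring.
    rewrite Rabs_mult in Hf.
    pose proof (Rle_abs (f (x + sqrt t * y) - f (x + sqrt u * y))).
    assert (Hy : Rabs y <= (1 + y ^ 2) / 2).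
    { assert (E : y ^ 2 = Rabs y ^ 2) by (rewrite RPow_abs; symmetry; apply Rabs_pos_eq, pow2_ge_0).
      rewrite E. pose proof (pow2_ge_0 (Rabs y - 1)). lra. }
    apply (Rmult_le_compat_l q) in Hy; auto. unfold q in *. lra.
  - eapply Rle_trans; [apply scheme_subadd|]. apply Rplus_le_compat_l.
    assert (HP := PolyUp_scheme sl su Hsl Hsu (1 / INR n) n (fun y => q / 2 * (1 + y ^ 2))
      ltac:(apply Rdiv_le_0_compat; lra) 0 (q / 2) 0 q 0 (Rle_refl 0)).
    rewrite Gfun_pos in HP by auto.
    replace (INR n * (1 / INR n)) with 1 in HP by (field; lra).
    specialize (HP ltac:(intros y; right; field)). lra.
Qed.

Lemma heat_continuous L f : Lip L f ->
  continuous_closed_half_plane (fun t x => heat sl su t f x).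
Proof.
  intros Hf t x Ht.
  assert (HL := Lip_nonneg L f Hf).
  intros P [eps HP]. unfold filtermap, within.
  set (K := L * ((1 + su ^ 2) / 2)).
  assert (HK : 0 <= K).
  { apply Rmult_le_pos; auto. pose proof (pow2_ge_0 su). lra. }
  set (d := eps / (2 * (K + 1))).
  assert (Hd : 0 < d) by (apply Rdiv_lt_0_compat; [apply cond_pos | lra]).
  assert (Hc := continuous_sqrt t (ball (sqrt t) d) (locally_ball _ (mkposreal d Hd))).
  destruct Hc as [dl Hdl].
  set (d' := eps / (2 * (L + 1))).
  assert (Hd' : 0 < d') by (apply Rdiv_lt_0_compat; [apply cond_pos | lra]).
  assert (Hm : 0 < Rmin dl d') by (apply Rmin_pos; [apply cond_pos | auto]).
  exists (mkposreal _ Hm). intros [s y] [Hs Hy] Hs0. cbn [fst snd pos] in *.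
  apply HP.
  assert (H1 : Rabs (sqrt s - sqrt t) < d).
  { apply Hdl. eapply ball_le; [|exact Hs]. apply Rmin_l. }
  assert (H2 : Rabs (y - x) < d').
  { eapply Rlt_le_trans; [exact Hy|]. apply Rmin_r. }
  pose proof (heat_time_modulus L f s t y Hf Hs0 Ht) as A.
  pose proof (heat_time_modulus L f t s y Hf Ht Hs0) as B.
  rewrite (Rabs_minus_sym (sqrt t) (sqrt s)) in B.
  pose proof (Lip_heat L f t Hf y x) as C. apply Rabs_le_between in C.
  replace (L * Rabs (sqrt s - sqrt t) * ((1 + su ^ 2) / 2)) with (K * Rabs (sqrt s - sqrt t))
    in * by (unfold K; ring).
  assert (A1 : K * Rabs (sqrt s - sqrt t) <= K * d) by (apply Rmult_le_compat_l; lra).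
  assert (A2 : L * Rabs (y - x) <= L * d') by (apply Rmult_le_compat_l; lra).
  assert (E1 : (K + 1) * d = eps / 2) by (unfold d; field; lra).
  assert (E2 : (L + 1) * d' = eps / 2) by (unfold d'; field; lra).
  change (Rabs (heat sl su s f y - heat sl su t f x) < eps).
  apply Rabs_lt_between. lra.
Qed.

(** A single walk, run in blocks of [n] steps, visits the times [k * s]. One-step bounds thus pass
    to the limit before the semigroup law is available, as that law is deduced from existence and
    uniqueness. *)
Lemma heat_grid L f k s eps : Lip L f -> 0 < eps ->
  exists N, forall n y, (N <= n)%nat -> (1 <= n)%nat ->
    Rabs (scheme sl su (s / INR n) (k * n) f y - heat sl su (INR k * s) f y) <= eps.
Proof.
  intros Hf Heps. destruct k as [|k].
  - exists 0%nat. intros n y _ _. simpl. rewrite (heat_nonpos_time L) by (auto; lra).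
    rewrite Rminus_diag, Rabs_R0. lra.
  - destruct (heat_conv sl su Hsl Hsu L f (INR (S k) * s) eps Hf Heps) as [N HN].
    exists N. intros n y Hn Hn1. specialize (HN (S k * n)%nat y ltac:(nia) ltac:(nia)).
    replace (INR (S k) * s / INR (S k * n)) with (s / INR n) in HN; auto.
    rewrite mult_INR. field. split; apply not_0_INR; lia.
Qed.

Lemma PolyUp_heat L f k s : Lip L f -> 0 < s ->
  PolyUp sl su s (heat sl su (INR k * s) f) (heat sl su (INR (S k) * s) f).
Proof.
  intros Hf Hs x c p b C HC Hy. apply le_epsilon. intros eps Heps.
  destruct (heat_grid L f k s (eps / 2) Hf) as [N HN]; [lra|].
  destruct (heat_grid L f (S k) s (eps / 2) Hf) as [P HP]; [lra|].
  set (n := S (max N P)). assert (Hn0 : 0 < INR n) by (apply lt_0_INR; lia).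
  specialize (HP n x ltac:(lia) ltac:(lia)). apply Rabs_le_between in HP.
  assert (Hq : 0 <= s / INR n) by (apply Rdiv_le_0_compat; lra).
  assert (K := PolyUp_scheme sl su Hsl Hsu (s / INR n) n (scheme sl su (s / INR n) (k * n) f) Hq
    x (c + eps / 2) p b C HC).
  replace (INR n * (s / INR n)) with s in K by (field; lra).
  rewrite <- scheme_add in K. change (n + k * n)%nat with (S k * n)%nat in K.
  specialize (K ltac:(intros y; specialize (HN n y ltac:(lia) ltac:(lia));
    apply Rabs_le_between in HN; specialize (Hy y); lra)).
  lra.
Qed.

Lemma PolyLo_heat L f k s : Lip L f -> 0 < s ->
  PolyLo sl su s (heat sl su (INR k * s) f) (heat sl su (INR (S k) * s) f).
Proof.
  intros Hf Hs x c p b C HC Hy. apply le_epsilon. intros eps Heps.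
  destruct (heat_grid L f k s (eps / 2) Hf) as [N HN]; [lra|].
  destruct (heat_grid L f (S k) s (eps / 2) Hf) as [P HP]; [lra|].
  set (n := S (max N P)). assert (Hn0 : 0 < INR n) by (apply lt_0_INR; lia).
  specialize (HP n x ltac:(lia) ltac:(lia)). apply Rabs_le_between in HP.
  assert (Hq : 0 <= s / INR n) by (apply Rdiv_le_0_compat; lra).
  assert (K := PolyLo_scheme sl su Hsl Hsu (s / INR n) n (scheme sl su (s / INR n) (k * n) f) Hq
    x (c - eps / 2) p b C HC).
  replace (INR n * (s / INR n)) with s in K by (field; lra).
  rewrite <- scheme_add in K. change (n + k * n)%nat with (S k * n)%nat in K.
  specialize (K ltac:(intros y; specialize (HN n y ltac:(lia) ltac:(lia));
    apply Rabs_le_between in HN; specialize (Hy y); lra)).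
  lra.
Qed.

End HeatProps.

(** * Existence *)

Lemma derive_continuity_pt (f : R -> R) (l x : R) : is_derive f x l -> continuity_pt f x.
Proof. intros H. apply derivable_continuous_pt. exists l. now apply is_derive_Reals. Qed.

(** Only earlier times [t0 - s] are expanded, since one-step bounds run forward to [t0]. The slack
    [eta] absorbs the variation of derivatives that are merely continuous. *)
Lemma C12_taylor_upper psi t0 x0 eta : C12 psi -> 0 < t0 -> 0 < eta ->
  exists r, 0 < r /\ r <= t0 /\ forall s y, 0 <= s < r -> Rabs (y - x0) < r ->
    psi (t0 - s) y <= psi t0 x0 - s * (Dt psi t0 x0 - eta) + Defs.Dx psi t0 x0 * (y - x0)
      + (Dxx psi t0 x0 + eta) / 2 * (y - x0) ^ 2.
Proof.
  intros HC Ht0 Heta. set (a := Dxx psi t0 x0). set (p := Defs.Dx psi t0 x0).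
  destruct (HC t0 x0 Ht0) as [_ [_ [_ [_ [H5 [_ H7]]]]]].
  destruct (H5 (mkposreal eta Heta)) as [d1 Hd1].
  destruct (H7 (mkposreal eta Heta)) as [d2 Hd2]. cbn [pos] in *.
  assert (Hr : 0 < Rmin t0 (Rmin d1 d2))
    by (repeat apply Rmin_pos; auto; apply cond_pos).
  exists (Rmin t0 (Rmin d1 d2)). set (r := Rmin t0 (Rmin d1 d2)) in *.
  assert (Hr0 : r <= t0) by apply Rmin_l.
  assert (Hr1 : r <= d1) by (eapply Rle_trans; [apply Rmin_r | apply Rmin_l]).
  assert (Hr2 : r <= d2) by (eapply Rle_trans; [apply Rmin_r | apply Rmin_r]).
  split; [assumption|]. split; [assumption|]. intros s y Hs Hy.
  assert (T : psi (t0 - s) y <= psi t0 y - s * (Dt psi t0 x0 - eta)).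
  { destruct (MVT_gen (fun u => psi u y) (t0 - s) t0 (fun u => Dt psi u y)) as [c [Hc E]].
    - intros u Hu. rewrite Rmin_left, Rmax_right in Hu by lra.
      apply Derive_correct, (proj1 (HC u y ltac:(lra))).
    - intros u Hu. rewrite Rmin_left, Rmax_right in Hu by lra.
      apply (derive_continuity_pt _ (Dt psi u y)), Derive_correct, (proj1 (HC u y ltac:(lra))).
    - rewrite Rmin_left, Rmax_right in Hc by lra.
      specialize (Hd1 c y ltac:(apply Rabs_lt_between; lra) ltac:(lra)).
      apply Rabs_lt_between in Hd1.
      assert (s * (Dt psi t0 x0 - eta) <= s * Dt psi c y) by (apply Rmult_le_compat_l; lra).
      lra. }
  assert (HX1 : forall z, is_derive (psi t0) z (Defs.Dx psi t0 z))
    by (intros z; apply Derive_correct, (proj1 (proj2 (HC t0 z Ht0)))).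
  assert (HX2 : forall z, is_derive (Defs.Dx psi t0) z (Dxx psi t0 z))
    by (intros z; apply Derive_correct, (proj1 (proj2 (proj2 (HC t0 z Ht0))))).
  (* The slack makes the second derivative of [q] negative near [x0]; its first derivative vanishes
     there, so [q] is largest at [x0]. *)
  set (q := fun z => psi t0 z - (p * (z - x0) + (a + eta) / 2 * (z - x0) ^ 2)).
  assert (Hq : forall z, is_derive q z (Defs.Dx psi t0 z - (p + (a + eta) * (z - x0)))).
  { intros z. unfold q. apply (is_derive_minus (psi t0)); [apply HX1|].
    auto_derive; [trivial|]. field. }
  assert (X : q y <= q x0).
  { destruct (MVT_gen q x0 y (fun z => Defs.Dx psi t0 z - (p + (a + eta) * (z - x0)))) as [c [Hc E]].
    - intros z _. apply Hq.
    - intros z _. eapply derive_continuity_pt, Hq.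
    - destruct (MVT_gen (Defs.Dx psi t0) x0 c (Dxx psi t0)) as [d [Hd E2]].
      + intros z _. apply HX2.
      + intros z _. eapply derive_continuity_pt, HX2.
      + fold p in E2.
        assert (Hdx : Rabs (d - x0) < d2 /\ 0 <= (c - x0) * (y - x0)).
        { apply Rabs_lt_between in Hy. split.
          - apply Rabs_lt_between. unfold Rmin, Rmax in Hc, Hd.
            destruct (Rle_dec x0 y), (Rle_dec x0 c); lra.
          - unfold Rmin, Rmax in Hc. destruct (Rle_dec x0 y); nra. }
        destruct Hdx as [Hdx Hcy].
        specialize (Hd2 t0 d ltac:(rewrite Rminus_diag, Rabs_R0; apply cond_pos) Hdx).
        fold a in Hd2. apply Rabs_lt_between in Hd2.
        replace (Defs.Dx psi t0 c - (p + (a + eta) * (c - x0)))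
          with ((Dxx psi t0 d - a - eta) * (c - x0)) in E by lra.
        nra. }
  unfold q in X. rewrite !Rminus_diag in X. simpl in X. simpl. lra.
Qed.

(** If [Dt psi] exceeded [G (Dxx psi)] at a touching point, Taylor expansion nearby and boundedness
    far away would put [V (t0 - s)] below a quartic whose [C] does not depend on [s]. The one-step
    bound then gives [V t0 x0 <= V t0 x0 - s * gap + K * C * s ^ 2], absurd for small [s]. [G] is
    abstract so that [- G (- a)] is covered too, which yields the supersolution property. *)
Lemma viscosity_sub_of_quartic G K K' V :
  bounded_closed_half_plane V -> 0 <= K' ->
  (forall a b, 0 <= b -> G (a + b) <= G a + K' * b) ->
  (forall k s x c p b C, 0 < s -> 0 <= C ->
    (forall y, V (INR k * s) y <= c + p * (y - x) + b / 2 * (y - x) ^ 2 + C * (y - x) ^ 4) ->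
    V (INR (S k) * s) x <= c + s * G b + K * C * s ^ 2) ->
  viscosity_subsolution G V.
Proof.
  intros [M HM] HK' HG HV psi t0 x0 Ht0 HC Hloc.
  destruct (Rle_lt_dec (Dt psi t0 x0 - G (Dxx psi t0 x0)) 0) as [|Hpos]; auto. exfalso.
  set (P := Dt psi t0 x0) in *. set (a := Dxx psi t0 x0) in *. set (p := Defs.Dx psi t0 x0).
  set (eta := (P - G a) / (2 * (1 + K'))).
  assert (Heta : 0 < eta) by (apply Rdiv_lt_0_compat; lra).
  assert (Hgap : (P - G a) / 2 <= P - eta - G (a + eta)).
  { specialize (HG a eta ltac:(lra)).
    assert (eta * (1 + K') = (P - G a) / 2) by (unfold eta; field; lra). lra. }
  set (gap := (P - G a) / 2) in *. assert (Hgap0 : 0 < gap) by (unfold gap; lra).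
  destruct (C12_taylor_upper psi t0 x0 eta HC Ht0 Heta) as [r1 [Hr1 [Hr1t HT]]].
  destruct Hloc as [r2 Hr2].
  set (r := Rmin 1 (Rmin r1 r2)).
  assert (Hr : 0 < r) by (repeat apply Rmin_pos; auto; [lra | apply cond_pos]).
  assert (Hr_1 : r <= 1) by apply Rmin_l.
  assert (Hr_r1 : r <= r1) by (eapply Rle_trans; [apply Rmin_r | apply Rmin_l]).
  assert (Hr_r2 : r <= r2) by (eapply Rle_trans; [apply Rmin_r | apply Rmin_r]).
  (* [A] bounds the oscillation of [V] plus the time term. The summands of [C] make the quartic
     outweigh the constant, the linear and the quadratic term at distance at least [r]. *)
  set (A := 2 * Rabs M + Rabs (P - eta)).
  set (C := A / r ^ 4 + Rabs p / r ^ 3 + Rabs (a + eta) / (2 * r ^ 2)).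
  assert (HA : 0 <= A) by (unfold A; pose proof (Rabs_pos M); pose proof (Rabs_pos (P - eta)); lra).
  assert (Hpow : forall n, 0 < r ^ n) by (intros n; now apply pow_lt).
  assert (HC0 : 0 <= C).
  { unfold C. pose proof (Hpow 4%nat). pose proof (Hpow 3%nat). pose proof (Hpow 2%nat).
    repeat apply Rplus_le_le_0_compat; apply Rdiv_le_0_compat; try lra; try apply Rabs_pos. }
  assert (Hup : forall s y, 0 < s < r -> V (t0 - s) y <=
    (V t0 x0 - s * (P - eta)) + p * (y - x0) + (a + eta) / 2 * (y - x0) ^ 2 + C * (y - x0) ^ 4).
  { intros s y Hs.
    assert (H4 : 0 <= (y - x0) ^ 4)
      by (replace ((y - x0) ^ 4) with (((y - x0) ^ 2) ^ 2) by ring; apply pow2_ge_0).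
    destruct (Rlt_le_dec (Rabs (y - x0)) r) as [Hy|Hy].
    - specialize (HT s y ltac:(lra) ltac:(lra)). fold P a p in HT.
      specialize (Hr2 (t0 - s) y ltac:(apply Rabs_lt_between; lra) ltac:(lra)).
      assert (0 <= C * (y - x0) ^ 4) by (apply Rmult_le_pos; lra). lra.
    - set (z := y - x0) in *. set (m := Rabs z) in *.
      assert (Hm0 : 0 <= m) by apply Rabs_pos.
      assert (E2 : z ^ 2 = m ^ 2) by (unfold m; rewrite RPow_abs; symmetry; apply Rabs_pos_eq, pow2_ge_0).
      assert (E4 : z ^ 4 = m ^ 4)
        by (replace (z ^ 4) with (z ^ 2 * z ^ 2) by ring; rewrite E2; ring).
      assert (R4 : r ^ 4 <= m ^ 4) by (apply pow_incr; lra).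
      assert (R3 : r ^ 3 <= m ^ 3) by (apply pow_incr; lra).
      assert (R2 : r ^ 2 <= m ^ 2) by (apply pow_incr; lra).
      assert (B1 : A <= A / r ^ 4 * m ^ 4).
      { replace A with (A / r ^ 4 * r ^ 4) at 1 by (field; lra).
        apply Rmult_le_compat_l; auto. apply Rdiv_le_0_compat; auto. }
      assert (B2 : - (p * z) <= Rabs p / r ^ 3 * m ^ 4).
      { assert (Rabs (p * z) <= Rabs p / r ^ 3 * m ^ 4).
        { rewrite Rabs_mult. fold m.
          replace (Rabs p * m) with (Rabs p / r ^ 3 * (r ^ 3 * m)) by (field; lra).
          apply Rmult_le_compat_l.
          - apply Rdiv_le_0_compat; auto. apply Rabs_pos.
          - replace (m ^ 4) with (m ^ 3 * m) by ring. apply Rmult_le_compat_r; auto. }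
        pose proof (Rle_abs (- (p * z))). rewrite Rabs_Ropp in *. lra. }
      assert (B3 : - ((a + eta) / 2 * m ^ 2) <= Rabs (a + eta) / (2 * r ^ 2) * m ^ 4).
      { assert (- ((a + eta) / 2 * m ^ 2) <= Rabs (a + eta) / 2 * m ^ 2).
        { pose proof (Rle_abs (- (a + eta))). rewrite Rabs_Ropp in *.
          pose proof (pow2_ge_0 m). nra. }
        eapply Rle_trans; [exact H|].
        replace (Rabs (a + eta) / 2 * m ^ 2) with (Rabs (a + eta) / (2 * r ^ 2) * (r ^ 2 * m ^ 2))
          by (field; lra).
        apply Rmult_le_compat_l.
        - apply Rdiv_le_0_compat; [apply Rabs_pos |]. pose proof (Hpow 2%nat). lra.
        - replace (m ^ 4) with (m ^ 2 * m ^ 2) by ring. apply Rmult_le_compat_r; auto.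
          apply pow2_ge_0. }
      assert (V1 := HM (t0 - s) y ltac:(lra)). assert (V2 := HM t0 x0 ltac:(lra)).
      apply Rabs_le_between in V1. apply Rabs_le_between in V2.
      pose proof (Rle_abs M). pose proof (Rle_abs (P - eta)). pose proof (Rabs_pos (P - eta)).
      assert (s * (P - eta) <= Rabs (P - eta)) by nra.
      rewrite E4, E2. unfold C, A in *. nra. }
  (* With [s = t0 / INR (S k)] the time [t0 - s] is the grid time [INR k * s]. The two summands
     force [s < r] and make the second-order error smaller than [gap]. *)
  destruct (nfloor_ex (t0 / r + t0 * (Rabs (K * C) + 1) / gap)) as [k [_ Hk]].
  { apply Rplus_le_le_0_compat; apply Rdiv_le_0_compat; try lra.
    pose proof (Rabs_pos (K * C)). nra. }
  set (s := t0 / INR (S k)).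
  assert (Hk0 : 0 < INR (S k)) by (apply lt_0_INR; lia).
  rewrite <- S_INR in Hk.
  assert (Hs0 : 0 < s) by (apply Rdiv_lt_0_compat; lra).
  assert (Hst : INR (S k) * s = t0) by (unfold s; field; lra).
  assert (Hst' : INR k * s = t0 - s) by (rewrite <- Hst at 1; rewrite S_INR; ring).
  assert (Q1 : 0 <= t0 / r) by (apply Rdiv_le_0_compat; lra).
  assert (Q2 : 0 <= t0 * (Rabs (K * C) + 1) / gap)
    by (apply Rdiv_le_0_compat; [pose proof (Rabs_pos (K * C)); nra | lra]).
  assert (Hsr : s < r).
  { assert (t0 / r * r = t0) by (field; lra). apply Rmult_lt_reg_l with (INR (S k)); auto.
    rewrite Hst. nra. }
  assert (Hsg : s * (Rabs (K * C) + 1) < gap).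
  { assert (t0 * (Rabs (K * C) + 1) / gap * gap = t0 * (Rabs (K * C) + 1)) by (field; lra).
    apply Rmult_lt_reg_l with (INR (S k)); auto.
    rewrite <- Rmult_assoc, Hst. nra. }
  specialize (HV k s x0 (V t0 x0 - s * (P - eta)) p (a + eta) C Hs0 HC0).
  rewrite Hst', Hst in HV. specialize (HV (fun y => Hup s y (conj Hs0 Hsr))).
  pose proof (Rle_abs (K * C)).
  assert (s * (P - eta - G (a + eta)) <= s * (s * (Rabs (K * C) + 1))) by nra.
  apply Rmult_le_reg_l in H0; auto. lra.
Qed.

Lemma heat_solution sl su L phi M : 0 <= sl -> sl <= su -> Lip L phi ->
  (forall x, Rabs (phi x) <= M) ->
  G_heat_solution (Gfun sl su) phi (fun t x => heat sl su t phi x).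
Proof.
  intros Hsl Hsu HL HM.
  assert (HB : bounded_closed_half_plane (fun t x => heat sl su t phi x)).
  { exists M. intros t x _. now apply (heat_bound sl su Hsl Hsu L). }
  assert (Hs2 : 0 <= su ^ 2 / 2) by (pose proof (pow2_ge_0 su); lra).
  split; [exact HB|]. split; [|split; [|split]].
  - now apply (heat_continuous sl su Hsl Hsu L).
  - apply (viscosity_sub_of_quartic _ (3 * su ^ 4) (su ^ 2 / 2)); auto.
    + intros a b Hb. now apply Gfun_add_le.
    + intros k s x c p b C Hs HC Hy.
      pose proof (PolyUp_heat sl su Hsl Hsu L phi k s HL Hs x c p b C HC Hy). lra.
  - apply viscosity_super_of_opp.
    apply (viscosity_sub_of_quartic _ (3 * su ^ 4) (su ^ 2 / 2)); auto.
    + now apply bounded_opp.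
    + intros a b Hb. pose proof (Gfun_add_le sl su (- (a + b)) b Hsl Hsu Hb) as H.
      replace (- (a + b) + b) with (- a) in H by ring. lra.
    + intros k s x c p b C Hs HC Hy. unfold opp2 in *.
      pose proof (PolyLo_heat sl su Hsl Hsu L phi k s HL Hs x (- c) (- p) (- b) C HC) as H.
      specialize (H ltac:(intros y; specialize (Hy y); lra)). lra.
  - intros x. apply (heat_nonpos_time sl su Hsl Hsu L); auto. lra.
Qed.

(** The starting time is free: [t0 = 0] gives uniqueness, and a general [t0] gives the semigroup law
    when [u] is [heat] itself. *)
Lemma solution_eq_heat sl su L phi u t0 t x : 0 <= sl -> sl <= su ->
  bounded_closed_half_plane u -> continuous_closed_half_plane u ->
  viscosity_subsolution (Gfun sl su) u -> viscosity_supersolution (Gfun sl su) u ->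
  0 <= t0 -> 0 < t -> Lip L phi -> (forall y, u t0 y = phi y) ->
  u (t0 + t) x = heat sl su t phi x.
Proof.
  intros Hsl Hsu Hb Hc Hsub Hsup Ht0 Ht HL H0. apply Rle_antisym.
  - apply (subsolution_le_heat sl su Hsl Hsu u L); auto. intros y. rewrite H0. lra.
  - apply (heat_le_supersolution sl su u L); auto. intros y. rewrite H0. lra.
Qed.

(** * G-normal distributions and convolutions in terms of the semigroup *)

Lemma CbLip_Lip phi : CbLip phi -> exists L M, Lip L phi /\ forall x, Rabs (phi x) <= M.
Proof. intros [[M HM] [L HL]]. exists L, M. auto. Qed.

Lemma G_normal_heat sl su phi : 0 <= sl -> sl <= su -> CbLip phi ->
  G_normal (Gfun sl su) phi = heat sl su 1 phi 0.
Proof.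
  intros Hsl Hsu Hphi. destruct (CbLip_Lip phi Hphi) as [L [M [HL HM]]].
  unfold G_normal, G_heat.
  assert (Hsol := epsilon_spec (inhabits (fun _ _ : R => 0)) (G_heat_solution (Gfun sl su) phi)
    (ex_intro _ _ (heat_solution sl su L phi M Hsl Hsu HL HM))).
  destruct Hsol as [Hb [Hc [Hsub [Hsup H0]]]].
  replace 1 with (0 + 1) at 1 by ring.
  apply (solution_eq_heat sl su L); auto; lra.
Qed.

Lemma heat_semigroup sl su L M phi s t x : 0 <= sl -> sl <= su -> Lip L phi ->
  (forall y, Rabs (phi y) <= M) -> 0 <= s -> 0 < t ->
  heat sl su (s + t) phi x = heat sl su t (heat sl su s phi) x.
Proof.
  intros Hsl Hsu HL HM Hs Ht.
  destruct (heat_solution sl su L phi M Hsl Hsu HL HM) as [Hb [Hc [Hsub [Hsup _]]]].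
  exact (solution_eq_heat sl su L (heat sl su s phi) _ s t x Hsl Hsu Hb Hc Hsub Hsup Hs Ht
    (Lip_heat sl su Hsl Hsu L phi s HL) (fun y => eq_refl)).
Qed.

Lemma CbLip_heat sl su t phi : 0 <= sl -> sl <= su -> CbLip phi -> CbLip (heat sl su t phi).
Proof.
  intros Hsl Hsu Hphi. destruct (CbLip_Lip phi Hphi) as [L [M [HL HM]]]. split.
  - exists M. intros x. now apply (heat_bound sl su Hsl Hsu L).
  - exists L. now apply Lip_heat.
Qed.

Lemma CbLip_transl phi c : CbLip phi -> CbLip (fun y => phi (c + y)).
Proof.
  intros [[M HM] [L HL]]. split.
  - exists M. intros x. apply HM.
  - exists L. apply (Lip_transl L phi c HL).
Qed.

(** By translation invariance the inner functional, as a function of [x], is the second evolution of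
    [phi]; convolution is thus composition of operators, evaluated at 0. *)
Lemma convolution_heat sl1 su1 sl2 su2 phi : 0 <= sl1 -> sl1 <= su1 -> 0 <= sl2 -> sl2 <= su2 ->
  CbLip phi ->
  convolution (G_normal (Gfun sl1 su1)) (G_normal (Gfun sl2 su2)) phi
  = heat sl1 su1 1 (heat sl2 su2 1 phi) 0.
Proof.
  intros H1 H2 H3 H4 Hphi. unfold convolution.
  rewrite <- G_normal_heat by (auto using CbLip_heat). f_equal. extensionality x.
  rewrite G_normal_heat by (auto using CbLip_transl). rewrite heat_transl. f_equal. ring.
Qed.

Lemma heat_scale_vol sl su r t L phi x : 0 <= sl -> sl <= su -> 0 <= r -> 0 <= t -> Lip L phi ->
  heat (r * sl) (r * su) t phi x = heat sl su (r ^ 2 * t) phi x.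
Proof.
  intros Hsl Hsu Hr Ht HL. unfold heat. f_equal. apply Lim_seq_ext. intros n.
  assert (0 < INR (S n)) by (apply lt_0_INR; lia).
  rewrite scheme_scale_vol by (auto; apply Rdiv_le_0_compat; lra).
  f_equal. unfold Rdiv. ring.
Qed.

Lemma heat_commute_of_ratio sl su r phi : 0 <= sl -> sl <= su -> 0 < r -> CbLip phi ->
  heat sl su 1 (heat (r * sl) (r * su) 1 phi) 0 = heat (r * sl) (r * su) 1 (heat sl su 1 phi) 0.
Proof.
  intros Hsl Hsu Hr Hphi. destruct (CbLip_Lip phi Hphi) as [L [M [HL HM]]].
  assert (HL1 := Lip_heat sl su Hsl Hsu L phi 1 HL).
  rewrite (heat_scale_vol sl su r 1 L (heat sl su 1 phi)) by (auto; lra).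
  replace (heat (r * sl) (r * su) 1 phi) with (heat sl su (r ^ 2 * 1) phi)
    by (extensionality y; symmetry; apply (heat_scale_vol sl su r 1 L); auto; lra).
  rewrite Rmult_1_r. assert (0 < r ^ 2) by nra.
  rewrite <- !(heat_semigroup sl su L M) by (auto; lra). now rewrite Rplus_comm.
Qed.

(** * Song's eigenfunctions *)

Definition glue (c : R) (f g : R -> R) (x : R) : R := if Rle_dec x c then f x else g x.

Lemma is_derive_glue c (f g f' g' : R -> R) x :
  (forall z, is_derive f z (f' z)) -> (forall z, is_derive g z (g' z)) ->
  f c = g c -> f' c = g' c ->
  is_derive (glue c f g) x (glue c f' g' x).
Proof.
  intros Hf Hg H0 H1. apply is_derive_Reals. intros eps Heps.
  destruct (Rtotal_order x c) as [Hx|[Hx|Hx]].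
  - pose proof (Hf x) as D. apply is_derive_Reals in D. destruct (D eps Heps) as [d Hd].
    assert (Hm : 0 < Rmin d (c - x)) by (apply Rmin_pos; [apply cond_pos | lra]).
    exists (mkposreal _ Hm). intros h Hh0 Hh. cbn [pos] in Hh.
    pose proof (Rmin_l d (c - x)). pose proof (Rmin_r d (c - x)).
    unfold glue. destruct (Rle_dec (x + h) c), (Rle_dec x c); try lra.
    + apply Hd; auto. lra.
    + pose proof (Rle_abs h). lra.
  - subst x. pose proof (Hf c) as D. apply is_derive_Reals in D. destruct (D eps Heps) as [d1 Hd1].
    pose proof (Hg c) as E. apply is_derive_Reals in E. destruct (E eps Heps) as [d2 Hd2].
    assert (Hm : 0 < Rmin d1 d2) by (apply Rmin_pos; apply cond_pos).
    exists (mkposreal _ Hm). intros h Hh0 Hh. cbn [pos] in Hh.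
    pose proof (Rmin_l d1 d2). pose proof (Rmin_r d1 d2).
    unfold glue. destruct (Rle_dec (c + h) c), (Rle_dec c c); try lra.
    + apply Hd1; auto. lra.
    + rewrite H0, H1. apply Hd2; auto. lra.
  - pose proof (Hg x) as D. apply is_derive_Reals in D. destruct (D eps Heps) as [d Hd].
    assert (Hm : 0 < Rmin d (x - c)) by (apply Rmin_pos; [apply cond_pos | lra]).
    exists (mkposreal _ Hm). intros h Hh0 Hh. cbn [pos] in Hh.
    pose proof (Rmin_l d (x - c)). pose proof (Rmin_r d (x - c)).
    unfold glue. destruct (Rle_dec (x + h) c), (Rle_dec x c); try lra.
    + pose proof (Rle_abs (- h)). rewrite Rabs_Ropp in *. lra.
    + apply Hd; auto. lra.
Qed.

Lemma Lip_of_derive L (f f' : R -> R) : (forall z, is_derive f z (f' z)) ->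
  (forall z, Rabs (f' z) <= L) -> Lip L f.
Proof.
  intros Hf HL x y. destruct (MVT_gen f y x f') as [c [_ E]].
  - intros; apply Hf.
  - intros z _. eapply derive_continuity_pt, Hf.
  - rewrite E, Rabs_mult. apply Rmult_le_compat_r; [apply Rabs_pos | apply HL].
Qed.

Lemma Lip_glue L c f g : Lip L f -> Lip L g -> f c = g c -> Lip L (glue c f g).
Proof.
  intros Hf Hg H0.
  assert (K : forall x y, x <= c -> c < y -> Rabs (f x - g y) <= L * Rabs (x - y)).
  { intros x y Hx Hy. replace (f x - g y) with ((f x - f c) + (g c - g y)) by lra.
    eapply Rle_trans; [apply Rabs_triang|].
    pose proof (Hf x c) as A. pose proof (Hg c y) as B.
    replace (L * Rabs (x - y)) with (L * Rabs (x - c) + L * Rabs (c - y)).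
    - lra.
    - rewrite !(Rabs_left1 (_ - _)) by lra. ring. }
  intros x y. unfold glue. destruct (Rle_dec x c), (Rle_dec y c); auto.
  - apply K; lra.
  - rewrite Rabs_minus_sym, (Rabs_minus_sym x y). apply K; lra.
Qed.

(** Song's eigenfunction: [b] is the ratio of the volatilities, and the phase
    moves at speed [k1] on the concave arc and [k2] on the convex arc. *)
Definition k1 (b : R) : R := (1 + b) / 2.
Definition k2 (b : R) : R := (1 + b) / (2 * b).

(** At the junction [PI / (1 + b)] both arcs vanish, the amplitudes [1 / k1 b] and [1 / k2 b] give
    both the slope -1, and both second derivatives vanish: the profile is twice differentiable. *)
Definition arc (b : R) : R -> R :=
  glue (PI / (1 + b)) (fun z => cos (k1 b * z) / k1 b) (fun z => - cos (k2 b * (PI - z)) / k2 b).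
Definition arc1 (b : R) : R -> R :=
  glue (PI / (1 + b)) (fun z => - sin (k1 b * z)) (fun z => - sin (k2 b * (PI - z))).
Definition arc2 (b : R) : R -> R :=
  glue (PI / (1 + b)) (fun z => - k1 b * cos (k1 b * z)) (fun z => k2 b * cos (k2 b * (PI - z))).

(** [acos (cos x)] folds the line onto [[0, PI]], which makes the function even and
    [2 * PI]-periodic. *)
Definition song (b x : R) : R := arc b (acos (cos x)).

(** [e] records whether the isometry that moves [x] to [th] preserves or reverses orientation. *)
Lemma cos_reduction x : exists th e, 0 <= th <= PI /\ (e = 1 \/ e = -1) /\
  forall z, cos (x + z) = cos (th + e * z).
Proof.
  assert (HPI := PI_RGT_0).
  assert (K : forall x, 0 <= x -> exists th e, 0 <= th <= PI /\ (e = 1 \/ e = -1) /\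
    forall z, cos (x + z) = cos (th + e * z)).
  { clear x. intros x Hx. destruct (nfloor_ex (x / (2 * PI))) as [n [Hn1 Hn2]].
    { apply Rdiv_le_0_compat; lra. }
    set (r := x - 2 * INR n * PI).
    assert (Hr : 0 <= r < 2 * PI).
    { apply (Rmult_le_compat_r (2 * PI)) in Hn1; [|lra].
      apply (Rmult_lt_compat_r (2 * PI)) in Hn2; [|lra].
      replace (x / (2 * PI) * (2 * PI)) with x in * by (field; lra). unfold r. lra. }
    destruct (Rle_dec r PI).
    - exists r, 1. split; [lra|]. split; [now left|]. intros z.
      rewrite <- (cos_period (r + 1 * z) n). f_equal. unfold r. ring.
    - exists (2 * PI - r), (-1). split; [lra|]. split; [now right|]. intros z.
      rewrite <- (cos_neg (x + z)), <- (cos_period (- (x + z)) (S n)).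
      f_equal. rewrite S_INR. unfold r. ring. }
  destruct (Rle_dec 0 x) as [Hx|Hx]; [now apply K|].
  destruct (K (- x) ltac:(lra)) as [th [e [H1 [H2 H3]]]].
  exists th, (- e). split; [assumption|]. split; [destruct H2; [right | left]; lra|].
  intros z. rewrite <- (cos_neg (x + z)). replace (- (x + z)) with (- x + - z) by ring.
  rewrite H3. f_equal. ring.
Qed.

Section Arc.
Variable b : R.
Hypothesis Hb : 1 <= b.

Let th0 := PI / (1 + b).

Lemma k1_ge1 : 1 <= k1 b.
Proof. unfold k1. lra. Qed.

Lemma k2_pos : 0 < k2 b.
Proof. unfold k2. apply Rdiv_lt_0_compat; lra. Qed.

Lemma k1_k2 : k1 b = b * k2 b.
Proof. unfold k1, k2. field. lra. Qed.

Lemma k2_le1 : k2 b <= 1.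
Proof.
  unfold k2. apply Rmult_le_reg_r with (2 * b); [lra|].
  replace ((1 + b) / (2 * b) * (2 * b)) with (1 + b) by (field; lra). lra.
Qed.

Lemma k1_th0 : k1 b * th0 = PI / 2.
Proof. unfold k1, th0. field. lra. Qed.

Lemma k2_th0 : k2 b * (PI - th0) = PI / 2.
Proof. unfold k2, th0. field. lra. Qed.

Lemma th0_bounds : 0 < th0 /\ 2 * th0 <= PI.
Proof.
  assert (HPI := PI_RGT_0). unfold th0. split; [apply Rdiv_lt_0_compat; lra|].
  apply Rmult_le_reg_r with (1 + b); [lra|].
  replace (2 * (PI / (1 + b)) * (1 + b)) with (2 * PI) by (field; lra). nra.
Qed.

Lemma is_derive_arc x : is_derive (arc b) x (arc1 b x).
Proof.
  assert (H1 := k1_ge1). assert (H2 := k2_pos).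
  apply is_derive_glue.
  - intros z. auto_derive; [trivial|]. field. lra.
  - intros z. auto_derive; [trivial|]. unfold Rminus. field. lra.
  - fold th0. rewrite k1_th0, k2_th0, cos_PI2. field. lra.
  - fold th0. rewrite k1_th0, k2_th0. reflexivity.
Qed.

Lemma is_derive_arc1 x : is_derive (arc1 b) x (arc2 b x).
Proof.
  apply is_derive_glue.
  - intros z. auto_derive; [trivial|]. ring.
  - intros z. auto_derive; [trivial|]. unfold Rminus. ring.
  - fold th0. rewrite k1_th0, k2_th0. reflexivity.
  - fold th0. rewrite k1_th0, k2_th0, cos_PI2. ring.
Qed.

Lemma Rabs_sin_le z : Rabs (sin z) <= 1.
Proof. pose proof (SIN_bound z). apply Rabs_le. lra. Qed.

Lemma Rabs_cos_le z : Rabs (cos z) <= 1.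
Proof. pose proof (COS_bound z). apply Rabs_le. lra. Qed.

Lemma arc1_bound z : Rabs (arc1 b z) <= 1.
Proof. unfold arc1, glue. destruct (Rle_dec _ _); rewrite Rabs_Ropp; apply Rabs_sin_le. Qed.

Lemma arc2_bound z : Rabs (arc2 b z) <= k1 b.
Proof.
  assert (H1 := k1_ge1). assert (H2 := k2_pos). assert (H3 := k2_le1).
  unfold arc2, glue. destruct (Rle_dec _ _); rewrite Rabs_mult.
  - rewrite Rabs_Ropp, (Rabs_pos_eq (k1 b)) by lra. pose proof (Rabs_cos_le (k1 b * z)). nra.
  - rewrite (Rabs_pos_eq (k2 b)) by lra. pose proof (Rabs_cos_le (k2 b * (PI - z))).
    pose proof (Rabs_pos (cos (k2 b * (PI - z)))). nra.
Qed.

Lemma arc_bound z : Rabs (arc b z) <= / k2 b.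
Proof.
  assert (H1 := k1_ge1). assert (H2 := k2_pos). assert (H3 := k2_le1).
  assert (HI : 0 < / k2 b) by now apply Rinv_0_lt_compat.
  assert (HJ : 0 < / k1 b) by (apply Rinv_0_lt_compat; lra).
  assert (HIJ : / k1 b <= / k2 b) by (apply Rinv_le_contravar; lra).
  unfold arc, glue. destruct (Rle_dec _ _); unfold Rdiv; rewrite Rabs_mult.
  - rewrite (Rabs_pos_eq (/ k1 b)) by lra. pose proof (Rabs_cos_le (k1 b * z)).
    pose proof (Rabs_pos (cos (k1 b * z))). nra.
  - rewrite Rabs_Ropp, (Rabs_pos_eq (/ k2 b)) by lra. pose proof (Rabs_cos_le (k2 b * (PI - z))).
    pose proof (Rabs_pos (cos (k2 b * (PI - z)))). nra.
Qed.

Lemma Lip_arc : Lip 1 (arc b).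
Proof. apply (Lip_of_derive 1 _ (arc1 b)); [apply is_derive_arc | apply arc1_bound]. Qed.

Lemma Lip_arc2 : Lip (k1 b ^ 2) (arc2 b).
Proof.
  assert (H1 := k1_ge1). assert (H2 := k2_pos). assert (H3 := k2_le1).
  assert (H4 : k2 b ^ 2 <= k1 b ^ 2) by (apply pow_incr; lra).
  apply Lip_glue.
  - apply (Lip_of_derive _ _ (fun z => k1 b ^ 2 * sin (k1 b * z))).
    + intros z. auto_derive; [trivial|]. ring.
    + intros z. rewrite Rabs_mult, Rabs_pos_eq by nra. pose proof (Rabs_sin_le (k1 b * z)). nra.
  - apply (Lip_of_derive _ _ (fun z => k2 b ^ 2 * sin (k2 b * (PI - z)))).
    + intros z. auto_derive; [trivial|]. unfold Rminus. ring.
    + intros z. rewrite Rabs_mult, Rabs_pos_eq by nra.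
      pose proof (Rabs_sin_le (k2 b * (PI - z))). pose proof (Rabs_pos (sin (k2 b * (PI - z)))). nra.
  - fold th0. rewrite k1_th0, k2_th0, cos_PI2. ring.
Qed.

(** Each arc is a cosine symmetric about its extremum, at 0 or at [PI], so the folded function
    follows the unfolded formula past the folds and has no corner there. The margin of at least
    [th0] on both sides of [[0, PI]] gives [song_local] its uniform radius. *)
Lemma song_arc y : - th0 < y < 2 * PI - th0 -> song b y = arc b y.
Proof.
  intros Hy. destruct th0_bounds as [T1 T2]. assert (HPI := PI_RGT_0). unfold song.
  destruct (Rlt_le_dec y 0) as [Hy0|Hy0]; [|destruct (Rle_lt_dec y PI) as [Hy1|Hy1]].
  - rewrite <- cos_neg, acos_cos by lra. unfold arc, glue. fold th0.
    destruct (Rle_dec (- y) th0), (Rle_dec y th0); try lra.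
    replace (k1 b * - y) with (- (k1 b * y)) by ring. now rewrite cos_neg.
  - now rewrite acos_cos by lra.
  - replace (cos y) with (cos (2 * PI - y))
      by (rewrite <- (cos_neg y), <- (cos_period (- y) 1); f_equal; simpl; ring).
    rewrite acos_cos by lra. unfold arc, glue. fold th0.
    destruct (Rle_dec (2 * PI - y) th0), (Rle_dec y th0); try lra.
    replace (k2 b * (PI - (2 * PI - y))) with (- (k2 b * (PI - y))) by ring. now rewrite cos_neg.
Qed.

Lemma song_bound x : Rabs (song b x) <= / k2 b.
Proof. apply arc_bound. Qed.

Lemma song_local x : exists th e, 0 <= th <= PI /\ (e = 1 \/ e = -1) /\ song b x = arc b th /\
  forall y, Rabs (y - x) < th0 -> song b y = arc b (th + e * (y - x)).
Proof.
  destruct (cos_reduction x) as [th [e [Hth [He Hcos]]]]. destruct th0_bounds as [T1 T2].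
  exists th, e. split; [assumption|]. split; [assumption|].
  assert (K : forall y, Rabs (y - x) < th0 -> song b y = arc b (th + e * (y - x))).
  { intros y Hy. rewrite <- song_arc.
    - unfold song. do 2 f_equal. rewrite <- Hcos. f_equal. ring.
    - apply Rabs_lt_between in Hy. destruct He; subst e; lra. }
  split; [|exact K].
  rewrite (K x) by (rewrite Rminus_diag, Rabs_R0; lra). f_equal. ring.
Qed.

Lemma Lip_song : Lip (1 + 2 * / k2 b / th0) (song b).
Proof.
  intros y x. destruct (song_local x) as [th [e [Hth [He [Hx Hy]]]]].
  destruct th0_bounds as [T1 T2].
  assert (HI : 0 < / k2 b) by (apply Rinv_0_lt_compat, k2_pos).
  assert (HI2 : 0 < 2 * / k2 b / th0) by (apply Rdiv_lt_0_compat; lra).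
  destruct (Rlt_le_dec (Rabs (y - x)) th0) as [H|H].
  - rewrite Hy, Hx by assumption. eapply Rle_trans; [apply Lip_arc|].
    replace (th + e * (y - x) - th) with (e * (y - x)) by ring. rewrite Rabs_mult.
    replace (Rabs e) with 1 by (destruct He; subst e; [now rewrite Rabs_R1 | rewrite Rabs_left; lra]).
    pose proof (Rabs_pos (y - x)). nra.
  - pose proof (song_bound x) as A. pose proof (song_bound y) as B.
    apply Rabs_le_between in A. apply Rabs_le_between in B.
    apply (Rmult_le_compat_l (2 * / k2 b / th0)) in H; [|lra].
    replace (2 * / k2 b / th0 * th0) with (2 * / k2 b) in H by (assert (K2 := k2_pos); field; lra).
    pose proof (Rabs_pos (y - x)). apply Rabs_le. lra.
Qed.

(** [G] uses [sl] on the concave arc and [su] on the convex one. The two decay rates agree because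
    [sl * k1 b = su * k2 b], which is what dictates the ratio of the speeds. *)
Lemma Gfun_arc2 sl su th : 0 < sl -> su = b * sl -> 0 <= th <= PI ->
  Gfun sl su (arc2 b th) = - (sl ^ 2 * k1 b ^ 2 / 2) * arc b th.
Proof.
  intros Hsl Hsu Hth. assert (H1 := k1_ge1). assert (H2 := k2_pos). assert (HPI := PI_RGT_0).
  unfold arc2, arc, glue. fold th0. destruct (Rle_dec th th0) as [H|H].
  - assert (0 <= cos (k1 b * th)).
    { apply cos_ge_0; [nra|]. rewrite <- k1_th0. apply Rmult_le_compat_l; lra. }
    rewrite Gfun_neg by nra. field. lra.
  - assert (0 <= cos (k2 b * (PI - th))).
    { apply cos_ge_0; [nra|]. rewrite <- k2_th0. apply Rmult_le_compat_l; lra. }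
    rewrite Gfun_pos by nra. rewrite Hsu, k1_k2. field. lra.
Qed.

(** The one-step bounds take inequalities valid on the whole line. Beyond distance [th0] the Taylor
    estimate is replaced by crude bounds: the three terms of [F] pay for the values, the slope and
    the curvature. *)
Lemma song_cubic : exists K, 0 <= K /\ forall sl su x, 0 < sl -> su = b * sl ->
  exists p B, Gfun sl su B = - (sl ^ 2 * k1 b ^ 2 / 2) * song b x /\
    forall y, Rabs (song b y - (song b x + p * (y - x) + B / 2 * (y - x) ^ 2))
      <= K * Rabs (y - x) ^ 3.
Proof.
  destruct th0_bounds as [T1 T2]. assert (H1 := k1_ge1). assert (H2 := k2_pos).
  assert (HI : 0 < / k2 b) by (apply Rinv_0_lt_compat, k2_pos).
  set (F := 2 * / k2 b / th0 ^ 3 + 1 / th0 ^ 2 + k1 b / (2 * th0)).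
  assert (P3 : 0 < th0 ^ 3) by now apply pow_lt.
  assert (P2 : 0 < th0 ^ 2) by now apply pow_lt.
  assert (HF : 0 <= F).
  { unfold F. repeat apply Rplus_le_le_0_compat; apply Rdiv_le_0_compat; lra. }
  exists (k1 b ^ 2 + F). split; [nra|].
  intros sl su x Hsl Hsu. destruct (song_local x) as [th [e [Hth [He [Hx Hy]]]]].
  (* A reversal of orientation flips the slope but not the curvature. *)
  exists (e * arc1 b th), (arc2 b th).
  split; [rewrite Hx; now apply Gfun_arc2|].
  intros y. set (z := y - x).
  assert (HM : 0 <= Rabs z) by apply Rabs_pos.
  assert (HM3 : 0 <= Rabs z ^ 3) by now apply pow_le.
  assert (Ee : Rabs (e * z) = Rabs z).
  { rewrite Rabs_mult. replace (Rabs e) with 1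
      by (destruct He; subst e; [now rewrite Rabs_R1 | rewrite Rabs_left; lra]). ring. }
  assert (Ee2 : (e * z) ^ 2 = z ^ 2) by (destruct He; subst e; ring).
  destruct (Rlt_le_dec (Rabs z) th0) as [H|H].
  - pose proof (taylor_cubic (arc b) (arc1 b) (arc2 b) (k1 b ^ 2) th (th + e * z)
      is_derive_arc is_derive_arc1 (fun u => Lip_arc2 u th)) as T.
    replace (th + e * z - th) with (e * z) in T by ring. rewrite Ee, Ee2 in T.
    rewrite (Hy y H), Hx. fold z.
    replace (e * arc1 b th * z) with (arc1 b th * (e * z)) by ring.
    eapply Rle_trans; [exact T|]. apply Rmult_le_compat_r; lra.
  - assert (M1 : th0 ^ 3 <= Rabs z ^ 3) by (apply pow_incr; lra).
    assert (M2 : th0 ^ 2 <= Rabs z ^ 2) by (apply pow_incr; lra).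
    assert (B0 : 2 * / k2 b <= 2 * / k2 b / th0 ^ 3 * Rabs z ^ 3).
    { replace (2 * / k2 b) with (2 * / k2 b / th0 ^ 3 * th0 ^ 3) at 1 by (field; split; lra).
      apply Rmult_le_compat_l; auto. apply Rdiv_le_0_compat; lra. }
    assert (B1 : Rabs (e * arc1 b th * z) <= 1 / th0 ^ 2 * Rabs z ^ 3).
    { replace (e * arc1 b th * z) with (arc1 b th * (e * z)) by ring.
      rewrite Rabs_mult, Ee. apply Rle_trans with (1 * Rabs z).
      - apply Rmult_le_compat_r; auto. apply arc1_bound.
      - replace (1 * Rabs z) with (1 / th0 ^ 2 * (th0 ^ 2 * Rabs z)) by (field; lra).
        apply Rmult_le_compat_l; [apply Rdiv_le_0_compat; lra|].
        replace (Rabs z ^ 3) with (Rabs z ^ 2 * Rabs z) by ring. apply Rmult_le_compat_r; auto. }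
    assert (B2 : Rabs (arc2 b th / 2 * z ^ 2) <= k1 b / (2 * th0) * Rabs z ^ 3).
    { assert (E2 : z ^ 2 = Rabs z ^ 2) by (rewrite RPow_abs; symmetry; apply Rabs_pos_eq, pow2_ge_0).
      rewrite E2, Rabs_mult, (Rabs_pos_eq (Rabs z ^ 2)) by apply pow2_ge_0.
      replace (k1 b / (2 * th0) * Rabs z ^ 3)
        with (k1 b / 2 * (Rabs z / th0 * Rabs z ^ 2)) by (field; lra).
      unfold Rdiv at 1. rewrite Rabs_mult, (Rabs_pos_eq (/ 2)) by lra.
      rewrite Rmult_assoc. unfold Rdiv at 1. rewrite Rmult_assoc.
      apply Rmult_le_compat; [apply Rabs_pos | | apply arc2_bound |].
      - apply Rmult_le_pos; [lra | apply pow2_ge_0].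
      - apply Rmult_le_compat_l; [lra|].
        rewrite <- (Rmult_1_l (Rabs z ^ 2)) at 1. apply Rmult_le_compat_r; [apply pow2_ge_0|].
        apply Rmult_le_reg_r with th0; auto.
        replace (Rabs z / th0 * th0) with (Rabs z) by (field; lra). lra. }
    pose proof (song_bound x) as A. pose proof (song_bound y) as B.
    apply Rabs_le_between in A. apply Rabs_le_between in B.
    apply Rabs_le_between in B1. apply Rabs_le_between in B2.
    assert (0 <= k1 b ^ 2 * Rabs z ^ 3) by (apply Rmult_le_pos; auto; apply pow2_ge_0).
    unfold F. apply Rabs_le. lra.
Qed.

Lemma song_0 : song b 0 = / k1 b.
Proof.
  destruct th0_bounds. rewrite song_arc by lra. unfold arc, glue. fold th0.
  destruct (Rle_dec 0 th0); [|lra]. rewrite Rmult_0_r, cos_0. unfold Rdiv. ring.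
Qed.

Lemma CbLip_song : CbLip (song b).
Proof. split; eexists; [apply song_bound | apply Lip_song]. Qed.

(** The two lines cross at the junction, and [k2 b <= k1 b] makes the minimum switch from the first
    to the second. Slopes for different ratios can then be compared through their phases. *)
Lemma arc1_phase z : arc1 b z = - sin (Rmin (k1 b * z) (PI - k2 b * (PI - z))).
Proof.
  assert (H1 := k1_ge1). assert (H2 := k2_le1).
  unfold arc1, glue. fold th0.
  assert (E : (k1 b * z - (PI - k2 b * (PI - z))) = (k1 b - k2 b) * (z - th0)).
  { pose proof k1_th0. pose proof k2_th0. nra. }
  destruct (Rle_dec z th0).
  - rewrite Rmin_left by nra. reflexivity.
  - rewrite Rmin_right by nra. now rewrite sin_PI_x.
Qed.

Lemma arc_PI : arc b PI = - / k2 b.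
Proof.
  destruct th0_bounds. unfold arc, glue. fold th0.
  destruct (Rle_dec PI th0); [pose proof PI_RGT_0; lra|].
  rewrite Rminus_diag, Rmult_0_r, cos_0. unfold Rdiv. ring.
Qed.

Lemma arc_0 : arc b 0 = / k1 b.
Proof. destruct th0_bounds. rewrite <- song_0, song_arc; lra. Qed.

End Arc.

(** * Comparison of eigenfunctions with different ratios *)

Definition phase (b z : R) : R := Rmin (k1 b * z) (PI - k2 b * (PI - z)).

Lemma phase_bounds b z : 1 <= b -> 0 <= z <= PI -> 0 <= phase b z <= PI.
Proof.
  intros Hb Hz. pose proof (k1_ge1 b Hb). pose proof (k2_pos b Hb). pose proof (k2_le1 b Hb).
  unfold phase, Rmin. destruct (Rle_dec _ _); nra.
Qed.

Lemma Rmin_le_both a b c d : a <= c -> b <= d -> Rmin a b <= Rmin c d.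
Proof.
  intros H1 H2. apply Rmin_glb.
  - eapply Rle_trans; [apply Rmin_l | exact H1].
  - eapply Rle_trans; [apply Rmin_r | exact H2].
Qed.

Lemma phase_mono b z z' : 1 <= b -> z <= z' -> phase b z <= phase b z'.
Proof.
  intros Hb Hz. pose proof (k1_ge1 b Hb). pose proof (k2_pos b Hb).
  apply Rmin_le_both; nra.
Qed.

Lemma phase_le b b' z : 1 <= b -> b <= b' -> 0 <= z <= PI -> phase b z <= phase b' z.
Proof.
  intros Hb Hbb Hz. apply Rmin_le_both.
  - apply Rmult_le_compat_r; [lra|]. unfold k1. lra.
  - assert (k2 b' <= k2 b).
    { unfold k2. apply Rmult_le_reg_r with (2 * b * b'); [nra|].
      replace ((1 + b') / (2 * b') * (2 * b * b')) with ((1 + b') * b) by (field; lra).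
      replace ((1 + b) / (2 * b) * (2 * b * b')) with ((1 + b) * b') by (field; lra). nra. }
    nra.
Qed.

Lemma sin_le_of_sum_le a a' : 0 <= a -> a <= a' -> a' <= PI -> a + a' <= PI -> sin a <= sin a'.
Proof.
  intros H1 H2 H3 H4. assert (E := form4 a' a).
  assert (0 <= cos ((a' + a) / 2)) by (apply cos_ge_0; lra).
  assert (0 <= sin ((a' - a) / 2)) by (apply sin_ge_0; lra). nra.
Qed.

(** The difference [D] of the two profiles equals [d] at both 0 and [PI]. Its derivative
    [sin (phase b' t) - sin (phase b t)] is nonnegative while the phases add up to at most [PI] and
    nonpositive afterwards, and the sum of phases is monotone; so [D] rises, then falls, and is
    least at the ends. *)
Lemma song_gap b b' : 1 <= b -> b < b' ->
  exists d, 0 < d /\ forall x, song b' x + d <= song b x.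
Proof.
  intros Hb Hbb. assert (Hb' : 1 <= b') by lra. assert (HPI := PI_RGT_0).
  set (d := / k1 b - / k1 b').
  assert (Hk : d = / k2 b' - / k2 b) by (unfold d, k1, k2; field; repeat split; lra).
  exists d. split.
  { unfold d. assert (/ k1 b' < / k1 b); [|lra].
    apply Rinv_lt_contravar; [|unfold k1; lra].
    pose proof (k1_ge1 b Hb). pose proof (k1_ge1 b' Hb'). nra. }
  intros x. unfold song. assert (Hz := acos_bound (cos x)). set (z := acos (cos x)) in *.
  enough (d <= arc b z - arc b' z) by lra.
  set (D := fun t => arc b t - arc b' t).
  assert (HD : forall t, is_derive D t (sin (phase b' t) - sin (phase b t))).
  { intros t. unfold D. evar_last.
    - apply (is_derive_minus (arc b) (arc b')); apply is_derive_arc; assumption.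
    - rewrite !arc1_phase by assumption. unfold minus, plus, opp, phase; simpl. ring. }
  change (d <= D z).
  destruct (Rle_dec (phase b z + phase b' z) PI) as [H|H].
  - assert (E0 : D 0 = d) by (unfold D; rewrite !arc_0 by assumption; reflexivity).
    destruct (MVT_gen D 0 z (fun t => sin (phase b' t) - sin (phase b t))) as [c [Hc E]].
    + intros; apply HD.
    + intros t _. eapply derive_continuity_pt, HD.
    + rewrite Rmin_left, Rmax_right in Hc by lra.
      assert (sin (phase b c) <= sin (phase b' c)).
      { apply sin_le_of_sum_le.
        - apply phase_bounds; auto; lra.
        - apply phase_le; lra.
        - apply phase_bounds; auto; lra.
        - pose proof (phase_mono b c z Hb ltac:(lra)).
          pose proof (phase_mono b' c z Hb' ltac:(lra)). lra. }
      rewrite <- E0. nra.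
  - assert (E0 : D PI = d) by (unfold D; rewrite !arc_PI by assumption; rewrite Hk; ring).
    destruct (MVT_gen D z PI (fun t => sin (phase b' t) - sin (phase b t))) as [c [Hc E]].
    + intros; apply HD.
    + intros t _. eapply derive_continuity_pt, HD.
    + rewrite Rmin_left, Rmax_right in Hc by lra.
      assert (sin (phase b' c) <= sin (phase b c)).
      { rewrite <- (sin_PI_x (phase b' c)), <- (sin_PI_x (phase b c)).
        pose proof (phase_bounds b c Hb ltac:(lra)). pose proof (phase_bounds b' c Hb' ltac:(lra)).
        pose proof (phase_le b b' c Hb ltac:(lra) ltac:(lra)).
        pose proof (phase_mono b z c Hb ltac:(lra)).
        pose proof (phase_mono b' z c Hb' ltac:(lra)).
        apply sin_le_of_sum_le; lra. }
      rewrite <- E0. nra.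
Qed.

(** * Commutation *)

(** Bernoulli's inequality together with [(1 - y) * (1 + y) <= 1]. At [y = c / INR n] it bounds the
    discrete decay factor by [/ (1 + c)], uniformly in [n]. *)
Lemma pow_one_minus_le y n : 0 <= y <= 1 -> (1 - y) ^ n * (1 + INR n * y) <= 1.
Proof.
  intros Hy. destruct (Req_dec y 0) as [->|Hy0].
  - rewrite Rminus_0_r, pow1. lra.
  - assert (H := poly n y ltac:(lra)).
    apply Rle_trans with ((1 - y) ^ n * (1 + y) ^ n).
    + apply Rmult_le_compat_l; [apply pow_le; lra | exact H].
    + rewrite <- Rpow_mult_distr. apply Rle_trans with (1 ^ n); [|rewrite pow1; lra].
      apply pow_incr. split; nra.
Qed.

(** * Decay of the eigenfunction under the evolution *)

Section Eigen.
Variables (sl su : R).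
Hypotheses (Hsl : 0 < sl) (Hsu : sl <= su).
Let b := su / sl.

Lemma ratio_ge1 : 1 <= b.
Proof.
  unfold b. apply Rmult_le_reg_r with sl; auto.
  replace (su / sl * sl) with su by (field; lra). lra.
Qed.

Lemma ratio_mul : su = b * sl.
Proof. unfold b. field. lra. Qed.

Let c := sl ^ 2 * k1 b ^ 2 / 2.

(** One step multiplies the profile by [1 - c * h] up to order [h * sqrt h]. The condition
    [c * h <= 1] keeps this factor nonnegative, as positive homogeneity demands, and since its
    powers are at most 1 the errors merely add up. *)
Lemma scheme_song : exists K, forall h n x, 0 < h -> c * h <= 1 ->
  Rabs (scheme sl su h n (song b) x - (1 - c * h) ^ n * song b x) <= INR n * (K * (h * sqrt h)).
Proof.
  assert (Hb := ratio_ge1). destruct (song_cubic b Hb) as [K [HK HC]].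
  exists (kappa su * K). intros h n x Hh Hch.
  assert (Hc : 0 <= c * h).
  { apply Rmult_le_pos; [|lra]. unfold c. apply Rdiv_le_0_compat; [|lra].
    apply Rmult_le_pos; apply pow2_ge_0. }
  set (q := 1 - c * h). set (E := kappa su * K * (h * sqrt h)).
  assert (S1 : forall y, q * song b y - E <= step sl su h (song b) y <= q * song b y + E).
  { intros y. destruct (HC sl su y Hsl ratio_mul) as [p [B [HG HB]]].
    assert (Hsl0 : 0 <= sl) by lra.
    assert (HU := PolyUp_scheme sl su Hsl0 Hsu h 1 (song b) ltac:(lra)).
    assert (HL := PolyLo_scheme sl su Hsl0 Hsu h 1 (song b) ltac:(lra)).
    simpl INR in HU, HL. rewrite Rmult_1_l in HU, HL.
    change (scheme sl su h 1 (song b)) with (step sl su h (song b)) in HU, HL.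
    assert (HU' := PolyUp_cubic sl su Hsl0 Hsu h _ _ y (song b y) p B K HU Hh HK
      ltac:(intros z; specialize (HB z); apply Rabs_le_between in HB; lra)).
    assert (HL' := PolyLo_cubic sl su Hsl0 Hsu h _ _ y (song b y) p B K HL Hh HK
      ltac:(intros z; specialize (HB z); apply Rabs_le_between in HB; lra)).
    rewrite HG in HU', HL'. fold c in HU', HL'. unfold q, E. split; lra. }
  revert x. induction n as [|n IH]; intros x.
  - simpl. replace (song b x - 1 * song b x) with 0 by ring. rewrite Rabs_R0. lra.
  - change (scheme sl su h (S n) (song b) x) with (step sl su h (scheme sl su h n (song b)) x).
    assert (Hq : 0 <= q ^ n <= 1).
    { split; [apply pow_le; unfold q; lra|]. rewrite <- (pow1 n). apply pow_incr. unfold q. lra. }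
    assert (HE : 0 <= E).
    { specialize (S1 0). lra. }
    assert (Sc : forall y, step sl su h (fun z => q ^ n * song b z) y = q ^ n * step sl su h (song b) y).
    { intros y. exact (scheme_scal sl su h 1 (q ^ n) (song b) y (proj1 Hq)). }
    assert (U : step sl su h (scheme sl su h n (song b)) x <= q ^ n * step sl su h (song b) x + INR n * E).
    { rewrite <- Sc, <- step_addc. apply step_le. intros y. specialize (IH y).
      apply Rabs_le_between in IH. lra. }
    assert (D : q ^ n * step sl su h (song b) x <= step sl su h (scheme sl su h n (song b)) x + INR n * E).
    { rewrite <- Sc, <- step_addc. apply step_le. intros y. specialize (IH y).
      apply Rabs_le_between in IH. lra. }
    destruct (S1 x) as [S2 S3].
    apply (Rmult_le_compat_l (q ^ n)) in S2; [|lra]. apply (Rmult_le_compat_l (q ^ n)) in S3; [|lra].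
    assert (q ^ n * E <= 1 * E) by (apply Rmult_le_compat_r; lra).
    rewrite S_INR. simpl pow. apply Rabs_le. lra.
Qed.

Lemma heat_song : exists r, 0 <= r < 1 /\ forall x, heat sl su 1 (song b) x = r * song b x.
Proof.
  assert (Hb := ratio_ge1). assert (Hk := k1_ge1 b Hb).
  assert (Hc : 0 < c).
  { unfold c. apply Rdiv_lt_0_compat; [|lra]. apply Rmult_lt_0_compat; apply pow_lt; lra. }
  destruct scheme_song as [K HK].
  assert (HL := Lip_song b Hb).
  assert (Happ : forall eps x, 0 < eps -> exists q, 0 <= q <= / (1 + c) /\
    forall y, y = x \/ y = 0 -> Rabs (heat sl su 1 (song b) y - q * song b y) <= eps).
  { intros eps x Heps.
    destruct (heat_conv sl su ltac:(lra) Hsu _ (song b) 1 (eps / 2) HL) as [N HN]; [lra|].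
    destruct (nfloor_ex ((2 * (Rabs K + 1) / eps) ^ 2 + c)) as [P [_ HP]].
    { apply Rplus_le_le_0_compat; [apply pow2_ge_0 | lra]. }
    set (n := S (max N P)).
    assert (HPn : INR P + 1 <= INR n) by (rewrite <- S_INR; apply le_INR; unfold n; lia).
    assert (Hpw := pow2_ge_0 (2 * (Rabs K + 1) / eps)).
    assert (Hn0 : 0 < INR n) by lra.
    assert (Hh : 0 < 1 / INR n) by (apply Rdiv_lt_0_compat; lra).
    assert (Hch : c * (1 / INR n) <= 1).
    { apply Rmult_le_reg_r with (INR n); auto.
      replace (c * (1 / INR n) * INR n) with c by (field; lra). lra. }
    assert (Hch0 : 0 <= c * (1 / INR n)) by (apply Rmult_le_pos; lra).
    exists ((1 - c * (1 / INR n)) ^ n). split.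
    - split; [apply pow_le; lra|].
      pose proof (pow_one_minus_le (c * (1 / INR n)) n (conj Hch0 Hch)) as H.
      replace (INR n * (c * (1 / INR n))) with c in H by (field; lra).
      apply Rmult_le_reg_r with (1 + c); [lra|]. rewrite Rinv_l by lra. exact H.
    - intros y _. specialize (HK (1 / INR n) n y Hh Hch).
      specialize (HN n y ltac:(unfold n; lia) ltac:(unfold n; lia)).
      assert (Hs : sqrt (1 / INR n) * (2 * (Rabs K + 1)) <= eps).
      { assert (Hd : 0 < eps / (2 * (Rabs K + 1)))
          by (pose proof (Rabs_pos K); apply Rdiv_lt_0_compat; lra).
        pose proof (Rabs_pos K).
        assert (sqrt (1 / INR n) <= eps / (2 * (Rabs K + 1))).
        { rewrite <- (sqrt_square (eps / (2 * (Rabs K + 1)))) by lra. apply sqrt_le_1_alt.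
          set (d := eps / (2 * (Rabs K + 1))) in *.
          replace (2 * (Rabs K + 1) / eps) with (/ d) in * by (unfold d; field; lra).
          apply Rmult_le_reg_r with (INR n); auto.
          replace (1 / INR n * INR n) with 1 by (field; lra).
          assert ((/ d) ^ 2 * (d * d) = 1) by (field; lra). nra. }
        replace eps with (eps / (2 * (Rabs K + 1)) * (2 * (Rabs K + 1))) by (field; lra).
        apply Rmult_le_compat_r; lra. }
      assert (INR n * (K * (1 / INR n * sqrt (1 / INR n))) <= eps / 2).
      { replace (INR n * (K * (1 / INR n * sqrt (1 / INR n)))) with (K * sqrt (1 / INR n)) by (field; lra).
        pose proof (Rle_abs K). pose proof (sqrt_pos (1 / INR n)). nra. }
      apply Rabs_le_between in HK. apply Rabs_le_between in HN. apply Rabs_le. lra. }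
  set (s0 := song b 0).
  assert (Hs0 : 0 < s0) by (unfold s0; rewrite song_0 by assumption; apply Rinv_0_lt_compat; lra).
  (* The eigenvalue is read off at 0, where the profile is positive. [Happ] provides one factor [q]
     for both 0 and [x], which carries the value over to [x]. *)
  exists (heat sl su 1 (song b) 0 / s0).
  assert (Hr : 0 <= heat sl su 1 (song b) 0 / s0 <= / (1 + c)).
  { split; apply le_epsilon; intros eps Heps.
    - destruct (Happ (eps * s0) 0 ltac:(nra)) as [q [Hq H]].
      specialize (H 0 (or_introl eq_refl)). fold s0 in H. apply Rabs_le_between in H.
      apply Rmult_le_reg_r with s0; auto.
      replace ((heat sl su 1 (song b) 0 / s0 + eps) * s0)
        with (heat sl su 1 (song b) 0 + eps * s0) by (field; lra). nra.
    - destruct (Happ (eps * s0) 0 ltac:(nra)) as [q [Hq H]].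
      specialize (H 0 (or_introl eq_refl)). fold s0 in H. apply Rabs_le_between in H.
      apply Rmult_le_reg_r with s0; auto.
      replace (heat sl su 1 (song b) 0 / s0 * s0)
        with (heat sl su 1 (song b) 0) by (field; lra). nra. }
  split.
  - assert (/ (1 + c) < 1) by (rewrite <- Rinv_1; apply Rinv_lt_contravar; lra). lra.
  - intros x. apply cond_eq. intros eps Heps.
    set (m := Rabs (song b x)). assert (Hm : 0 <= m) by apply Rabs_pos.
    set (eta := eps / (2 * (1 + m / s0))).
    assert (Hms : 0 <= m / s0) by (apply Rdiv_le_0_compat; lra).
    assert (Heta : 0 < eta) by (apply Rdiv_lt_0_compat; lra).
    destruct (Happ eta x Heta) as [q [_ H]].
    pose proof (H x (or_introl eq_refl)) as Hx. pose proof (H 0 (or_intror eq_refl)) as H0.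
    fold s0 in H0. set (h0 := heat sl su 1 (song b) 0) in *.
    replace (heat sl su 1 (song b) x - h0 / s0 * song b x) with
      ((heat sl su 1 (song b) x - q * song b x) + - ((h0 - q * s0) * (song b x / s0))) by (field; lra).
    eapply Rle_lt_trans; [apply Rabs_triang|]. rewrite Rabs_Ropp, Rabs_mult.
    assert (Rabs (song b x / s0) = m / s0).
    { unfold Rdiv. rewrite Rabs_mult, (Rabs_pos_eq (/ s0)); auto.
      left. now apply Rinv_0_lt_compat. }
    rewrite H1.
    assert (Rabs (h0 - q * s0) * (m / s0) <= eta * (m / s0)) by (apply Rmult_le_compat_r; lra).
    assert (eta * (1 + m / s0) = eps / 2) by (unfold eta; field; lra).
    lra.
Qed.

End Eigen.

Lemma pow_lt_eventually r A d : 0 <= r < 1 -> 0 < d -> exists n, r ^ n * A < d.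
Proof.
  intros Hr Hd.
  destruct (pow_lt_1_zero r) with (y := d / (Rabs A + 1)) as [N HN].
  - rewrite Rabs_pos_eq; lra.
  - apply Rdiv_lt_0_compat; [lra|]. pose proof (Rabs_pos A). lra.
  - exists N. specialize (HN N (Nat.le_refl N)).
    assert (Hp : 0 <= r ^ N) by (apply pow_le; lra). rewrite Rabs_pos_eq in HN by lra.
    pose proof (Rabs_pos A). pose proof (Rle_abs A).
    assert (r ^ N * (Rabs A + 1) < d).
    { replace d with (d / (Rabs A + 1) * (Rabs A + 1)) by (field; lra).
      apply Rmult_lt_compat_r; lra. }
    nra.
Qed.

Lemma iter_commute (P : (R -> R) -> Prop) (A B : (R -> R) -> R -> R) :
  (forall f, P f -> P (A f)) -> (forall f, P f -> P (B f)) ->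
  (forall f, P f -> A (B f) = B (A f)) ->
  forall n m f, P f -> Nat.iter n A (Nat.iter m B f) = Nat.iter m B (Nat.iter n A f).
Proof.
  intros HA HB HAB.
  assert (IA : forall n f, P f -> P (Nat.iter n A f)) by (intros n f Hf; induction n; simpl; auto).
  assert (IB : forall n f, P f -> P (Nat.iter n B f)) by (intros n f Hf; induction n; simpl; auto).
  assert (K : forall m f, P f -> A (Nat.iter m B f) = Nat.iter m B (A f)).
  { induction m as [|m IH]; intros f Hf; simpl; auto. rewrite HAB by auto. now rewrite IH. }
  induction n as [|n IH]; intros m f Hf; simpl; auto.
  rewrite IH by assumption. rewrite K by auto. reflexivity.
Qed.

Lemma not_commute_of_ratio_lt sl1 su1 sl2 su2 :
  0 < sl1 -> sl1 <= su1 -> 0 < sl2 -> sl2 <= su2 -> su1 / sl1 < su2 / sl2 ->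
  ~ (forall phi, CbLip phi ->
       heat sl1 su1 1 (heat sl2 su2 1 phi) 0 = heat sl2 su2 1 (heat sl1 su1 1 phi) 0).
Proof.
  intros H1 H2 H3 H4 Hlt Hcomm.
  assert (H1' : 0 <= sl1) by lra. assert (H3' : 0 <= sl2) by lra.
  set (A := heat sl1 su1 1) in *. set (B := heat sl2 su2 1) in *.
  assert (Hb1 := ratio_ge1 sl1 su1 H1 H2). assert (Hb2 := ratio_ge1 sl2 su2 H3 H4).
  set (b1 := su1 / sl1) in *. set (b2 := su2 / sl2) in *.
  assert (HA : forall f, CbLip f -> CbLip (A f)) by (intros; now apply CbLip_heat).
  assert (HB : forall f, CbLip f -> CbLip (B f)) by (intros; now apply CbLip_heat).
  (* The hypothesis speaks of the point 0 only; applied to all translates it becomes an identity of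
     functions. *)
  assert (HAB : forall f, CbLip f -> A (B f) = B (A f)).
  { intros f Hf. extensionality x. specialize (Hcomm _ (CbLip_transl f x Hf)).
    replace (B (fun y => f (x + y))) with (fun y => B f (x + y)) in Hcomm
      by (extensionality y; symmetry; apply heat_transl).
    replace (A (fun y => f (x + y))) with (fun y => A f (x + y)) in Hcomm
      by (extensionality y; symmetry; apply heat_transl).
    unfold A at 1, B at 2 in Hcomm. rewrite !heat_transl, Rplus_0_r in Hcomm. exact Hcomm. }
  assert (IA : forall n f, CbLip f -> CbLip (Nat.iter n A f)) by (intros n f Hf; induction n; simpl; auto).
  assert (IB : forall n f, CbLip f -> CbLip (Nat.iter n B f)) by (intros n f Hf; induction n; simpl; auto).
  assert (S1 := CbLip_song b1 Hb1). assert (S2 := CbLip_song b2 Hb2).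
  destruct (heat_song sl1 su1 H1 H2) as [r1 [Hr1 E1]]. fold A b1 in E1.
  destruct (heat_song sl2 su2 H3 H4) as [r2 [Hr2 E2]]. fold B b2 in E2.
  destruct (song_gap b1 b2 Hb1 Hlt) as [d [Hd Hgap]].
  assert (P1 : forall n x, Nat.iter n A (song b1) x = r1 ^ n * song b1 x).
  { induction n as [|n IH]; intros x; simpl; [ring|].
    rewrite (functional_extensionality _ _ IH). unfold A. rewrite heat_scal by (apply pow_le; lra).
    fold A. rewrite E1. ring. }
  (* [B] is monotone and commutes with constants, so [d] survives every application while the
     multiple of [song b2] decays. *)
  assert (P2 : forall m x, r2 ^ m * song b2 x + d <= Nat.iter m B (song b1) x).
  { induction m as [|m IH]; intros x; simpl; [specialize (Hgap x); lra|].
    destruct (CbLip_Lip _ (IB m _ S1)) as [L [_ [HL _]]].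
    destruct (CbLip_Lip _ S2) as [L2 [_ [HL2 _]]].
    assert (Hp : 0 <= r2 ^ m) by (apply pow_le; lra).
    assert (E : B (fun y => r2 ^ m * song b2 y) x = r2 ^ m * (r2 * song b2 x))
      by (unfold B; rewrite heat_scal by assumption; fold B; now rewrite E2).
    assert (Hs : Lip (r2 ^ m * L2) (fun y => r2 ^ m * song b2 y)).
    { intros u v. rewrite <- Rmult_minus_distr_l, Rabs_mult, Rabs_pos_eq, Rmult_assoc by assumption.
      apply Rmult_le_compat_l; auto. }
    assert (Hle : B (fun y => r2 ^ m * song b2 y) x <= B (Nat.iter m B (song b1)) x + - d).
    { apply (heat_le_addc sl2 su2 H3' H4 (r2 ^ m * L2) L); auto. intros y. specialize (IH y). lra. }
    rewrite E in Hle. lra. }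
  set (M2 := / k2 b2).
  destruct (pow_lt_eventually r2 M2 (d / 2) Hr2) as [m Hm]; [lra|].
  set (f := Nat.iter m B (song b1)).
  assert (Hf : forall x, d / 2 <= f x).
  { intros x. unfold f. eapply Rle_trans; [|apply P2].
    pose proof (song_bound b2 Hb2 x) as Hbd. fold M2 in Hbd. apply Rabs_le_between in Hbd.
    assert (0 <= r2 ^ m) by (apply pow_le; lra). nra. }
  assert (Hn : forall n x, d / 2 <= Nat.iter n A f x).
  { induction n as [|n IH]; intros x; simpl; auto.
    destruct (CbLip_Lip _ (IA n f (IB m _ S1))) as [L [_ [HL _]]].
    rewrite <- (heat_const sl1 su1 1 (d / 2) x).
    apply (heat_le sl1 su1 H1' H2 0 L); auto using Lip_const. }
  set (M1 := / k2 b1).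
  destruct (pow_lt_eventually r1 M1 (d / 2) Hr1) as [n Hn1]; [lra|].
  specialize (Hn n 0). unfold f in Hn. rewrite (iter_commute CbLip A B HA HB HAB) in Hn by assumption.
  rewrite (functional_extensionality _ _ (P1 n)) in Hn.
  (* In the other order [A] shrinks the profile first, and [B] cannot raise its upper bound above
     [r1 ^ n * M1], which is below [d / 2]. *)
  assert (Hup : forall k x, Nat.iter k B (fun y => r1 ^ n * song b1 y) x <= r1 ^ n * M1).
  { assert (Hp : 0 <= r1 ^ n) by (apply pow_le; lra).
    assert (Hs : CbLip (fun y => r1 ^ n * song b1 y))
      by (rewrite <- (functional_extensionality _ _ (P1 n)); auto).
    induction k as [|k IH]; intros x; simpl.
    - apply Rmult_le_compat_l; auto. pose proof (song_bound b1 Hb1 x) as Hbd.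
      apply Rabs_le_between in Hbd. unfold M1. lra.
    - destruct (CbLip_Lip _ (IB k _ Hs)) as [L [_ [HL _]]].
      rewrite <- (heat_const sl2 su2 1 (r1 ^ n * M1) x).
      apply (heat_le sl2 su2 H3' H4 L 0); auto using Lip_const. }
  specialize (Hup m 0). lra.
Qed.

Theorem theorem3p2 (sl1 su1 sl2 su2 : R)
  (hsl1 : 0 < sl1) (hsu1 : sl1 <= su1)
  (hsl2 : 0 < sl2) (hsu2 : sl2 <= su2) :
  eq_on_CbLip
    (convolution (G_normal (Gfun sl1 su1)) (G_normal (Gfun sl2 su2)))
    (convolution (G_normal (Gfun sl2 su2)) (G_normal (Gfun sl1 su1)))
  <-> su1 / sl1 = su2 / sl2.
Proof.
  assert (H1 : 0 <= sl1) by lra. assert (H2 : 0 <= sl2) by lra.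
  split.
  - intros H.
    assert (K : forall phi, CbLip phi ->
      heat sl1 su1 1 (heat sl2 su2 1 phi) 0 = heat sl2 su2 1 (heat sl1 su1 1 phi) 0).
    { intros phi Hphi. specialize (H phi Hphi).
      rewrite !convolution_heat in H by assumption. exact H. }
    destruct (Rtotal_order (su1 / sl1) (su2 / sl2)) as [Hlt|[Heq|Hgt]]; [exfalso|exact Heq|exfalso].
    + now apply (not_commute_of_ratio_lt sl1 su1 sl2 su2).
    + apply (not_commute_of_ratio_lt sl2 su2 sl1 su1); auto.
      intros phi Hphi. symmetry. now apply K.
  - intros H phi Hphi. rewrite !convolution_heat by assumption.
    set (r := sl2 / sl1). assert (Hr : 0 < r) by (apply Rdiv_lt_0_compat; lra).
    assert (E1 : sl2 = r * sl1) by (unfold r; field; lra).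
    assert (E2 : su2 = r * su1).
    { replace su2 with (su2 / sl2 * sl2) by (field; lra). rewrite <- H. unfold r. field. lra. }
    rewrite E1, E2. now apply heat_commute_of_ratio.
Qed.
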